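(* Let $F$ be a free group of finite rank with a fixed basis $A$. The shortest element problem in $F$ is in $\mathbf{P}$. That is, there is an algorithm which, given words $h_1,\dots,h_n$ in $A\cup A^{-1}$, finds a nontrivial element of the subgroup $H=\langle h_1,\dots,h_n\rangle\le F$ of least word length with respect to $A$, in time polynomial in the total length of the input words.
   Context: The word length $|f|$ of $f\in F$ is the length of the reduced word in $A\cup A^{-1}$ representing $f$. Shortest element problem in a group $G$ with fixed finite generating set: given a finitely generated subgroup $H$ of $G$ (by a finite list of generators written as words in the generators of $G$ and their inverses), find a shortest nontrivial element in $H$ in the word metric on $G$. (If $H$ is trivial there is no such element, and the algorithm reports this.) *)

(* Defs.v *)
From HB Require Import structures.
From mathcomp Require Import all_boot all_order all_algebra.

Set Implicit Arguments.
Unset Strict Implicit.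
Unset Printing Implicit Defensive.

(* (a, false) stands for the basis element a, and (a, true) for its inverse. *)
Notation letter A := (A * bool)%type.
Notation word A := (seq (letter A)).

Definition inv_letter (A : Type) (l : letter A) : letter A := (l.1, ~~ l.2).

Definition reduced (A : choiceType) (w : word A) : bool :=
  sorted (fun l m : letter A => m != inv_letter l) w.

(* The free group on A, realised as the set of reduced words; the product is
   concatenation followed by free reduction. *)
Record freeGroup (A : choiceType) : Type :=
  FreeGroup { reduced_word :> word A; _ : reduced reduced_word }.

HB.instance Definition _ (A : choiceType) := [isSub for @reduced_word A].
HB.instance Definition _ (A : choiceType) := [Choice of freeGroup A by <:].

Section FreeGroupTheory.
Variable A : choiceType.
Implicit Types (l m : letter A) (u v w : word A).

Definition push l w : word A :=
  if w is m :: w' then if m == inv_letter l then w' else l :: w else [:: l].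

Definition reduce w : word A := foldr push [::] w.

Definition inv_word w : word A := rev (map (@inv_letter A) w).

Lemma inv_letterK : involutive (@inv_letter A).
Proof. by case=> a b; rewrite /inv_letter /= negbK. Qed.

Lemma push_reduced l w : reduced w -> reduced (push l w).
Proof.
case: w => [|m w] //=; case: ifPn => [_|ml] pw; last by rewrite /= ml.
exact: path_sorted pw.
Qed.

Lemma foldr_push_reduced u w : reduced w -> reduced (foldr push w u).
Proof. by move=> rw; elim: u => //= l u IHu; apply: push_reduced. Qed.

Lemma reduce_reduced w : reduced (reduce w).
Proof. exact: foldr_push_reduced. Qed.

Lemma reduce_id w : reduced w -> reduce w = w.
Proof.
elim: w => //= l w IHw pw; rewrite IHw; last exact: path_sorted pw.
by case: w pw {IHw} => //= m w /andP[/negPf->].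
Qed.

Lemma pushK l w : reduced w -> push l (push (inv_letter l) w) = w.
Proof.
case: w => [|m w] /=; first by rewrite eqxx.
rewrite inv_letterK; have [->|ml] := eqVneq m l; last by rewrite /= eqxx.
by case: w => [|k w] //= /andP[/negPf->].
Qed.

Lemma foldr_push_push l u w :
  reduced w -> foldr push w (push l u) = push l (foldr push w u).
Proof.
case: u => [|m u] //= rw; case: eqP => //= ->.
by rewrite pushK // foldr_push_reduced.
Qed.

Lemma foldr_push_reduce u w :
  reduced w -> foldr push w (reduce u) = foldr push w u.
Proof. by move=> rw; elim: u => //= l u IHu; rewrite foldr_push_push ?IHu. Qed.

Lemma inv_word_reduced w : reduced w -> reduced (inv_word w).
Proof.
rewrite /reduced /inv_word rev_sorted sorted_map; apply: sub_sorted => l m /=.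
by rewrite inv_letterK; apply: contra => /eqP ->.
Qed.

Lemma foldr_push_inv_word u w :
  reduced w -> foldr push (foldr push w u) (inv_word u) = w.
Proof.
move=> rw; elim: u => //= l u IHu.
rewrite /inv_word /= rev_cons -cats1 foldr_cat /=.
by rewrite -{2}[l]inv_letterK pushK ?foldr_push_reduced.
Qed.

Definition fg_one : freeGroup A := @FreeGroup A [::] isT.
Definition fg_mul (f g : freeGroup A) : freeGroup A :=
  FreeGroup (reduce_reduced (f ++ g)).
Definition fg_inv (f : freeGroup A) : freeGroup A :=
  FreeGroup (inv_word_reduced (valP f)).

Lemma val_fg_mul f g : val (fg_mul f g) = foldr push (val g) (val f).
Proof. by rewrite /= /reduce foldr_cat -/(reduce g) reduce_id ?(valP g). Qed.

Lemma fg_mulA : associative fg_mul.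
Proof.
move=> f g h; apply: val_inj; rewrite [LHS]val_fg_mul [RHS]val_fg_mul.
rewrite val_fg_mul /= foldr_push_reduce ?foldr_cat //; exact: (valP h).
Qed.

Lemma fg_mul1g : left_id fg_one fg_mul.
Proof. by move=> f; apply: val_inj; rewrite val_fg_mul. Qed.

Lemma fg_mulg1 : right_id fg_one fg_mul.
Proof. by move=> f; apply: val_inj; rewrite val_fg_mul -[RHS]reduce_id ?(valP f). Qed.

Lemma fg_mulVg : left_inverse fg_one fg_inv fg_mul.
Proof.
move=> f; apply: val_inj; rewrite val_fg_mul /=.
by rewrite -{1}[reduced_word f]reduce_id ?(valP f) // foldr_push_inv_word.
Qed.

Lemma fg_mulgV : right_inverse fg_one fg_inv fg_mul.
Proof.
move=> f; rewrite -{1}(_ : fg_inv (fg_inv f) = f) ?fg_mulVg //.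
by apply: val_inj; rewrite /= /inv_word map_rev revK (mapK inv_letterK).
Qed.

HB.instance Definition _ := isGroup.Build (freeGroup A)
  fg_mulA fg_mul1g fg_mulg1 fg_mulVg fg_mulgV.

End FreeGroupTheory.

Definition basis_elt (A : choiceType) (a : A) : freeGroup A :=
  @FreeGroup A [:: (a, false)] isT.

Definition eval_letter (A : Type) (G : groupType) (x : A -> G) (l : letter A) : G :=
  (if l.2 then (x l.1)^-1 else x l.1)%g.

Definition eval_word (A : Type) (G : groupType) (x : A -> G) (w : word A) : G :=
  (\prod_(l <- w) eval_letter x l)%g.

Definition element_of (A : choiceType) (w : word A) : freeGroup A :=
  eval_word (@basis_elt A) w.

Lemma val_element_of (A : choiceType) (w : word A) :
  reduced_word (element_of w) = reduce w.
Proof.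
rewrite /element_of /eval_word; elim: w => [|l w IHw]; first by rewrite big_nil.
by rewrite big_cons [LHS]val_fg_mul /= IHw; case: l => a [].
Qed.

Lemma element_ofK (A : choiceType) : cancel (@reduced_word A) (@element_of A).
Proof.
by move=> f; apply: val_inj; rewrite /= val_element_of reduce_id ?(valP f).
Qed.

(* The universal property: freeGroup A is free with basis basis_elt. *)
Lemma freeGroup_universal (A : choiceType) (G : groupType) (x : A -> G) :
  exists phi : freeGroup A -> G,
    [/\ {morph phi : f g / (f * g)%g},
        forall a, phi (basis_elt a) = x a
      & forall psi : freeGroup A -> G,
          {morph psi : f g / (f * g)%g} ->
          (forall a, psi (basis_elt a) = x a) -> psi =1 phi].
Proof.
have ev_push l (w : word A) :
    eval_word x (push l w) = (eval_letter x l * eval_word x w)%g.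
  rewrite /eval_word; case: w => [|m w] /=; first by rewrite big_cons.
  case: eqP => [->|_]; last by rewrite big_cons.
  rewrite big_cons mulgA; case: l => a [] /=; rewrite /eval_letter /=.
    by rewrite mulVg mul1g.
  by rewrite mulgV mul1g.
exists (fun f => eval_word x f); split=> [f g|a|psi psiM psi_x f].
- have ->: reduced_word (f * g)%g = foldr (@push A) g f by exact: val_fg_mul.
  elim: (reduced_word f) => [|l u IHu] /=.
    by rewrite [X in (X * _)%g]/eval_word big_nil mul1g.
  by rewrite ev_push IHu /eval_word big_cons mulgA.
- by rewrite /eval_word big_seq1.
have psi1 : psi 1%g = 1%g by apply: (mulgI (psi 1%g)); rewrite -psiM !mulg1.
have psiV g : psi (g^-1)%g = ((psi g)^-1)%g.
  by apply: (mulgI (psi g)); rewrite -psiM !mulgV.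
rewrite -{1}[f]element_ofK /element_of /eval_word.
elim: (reduced_word f) => [|l u IHu]; first by rewrite !big_nil.
rewrite !big_cons psiM IHu; congr (_ * _)%g.
by case: l => a []; rewrite /eval_letter /= ?psiV psi_x.
Qed.

Definition word_length (A : choiceType) (f : freeGroup A) : nat :=
  size (reduced_word f).

Inductive generated (G : groupType) (s : seq G) : G -> Prop :=
| generated_mem x : x \in s -> generated s x
| generated_one : generated s 1%g
| generated_mul x y : generated s x -> generated s y -> generated s (x * y)%g
| generated_inv x : generated s x -> generated s (x^-1)%g.

(* Some w is an answer when w represents a shortest nontrivial element of
   H = <h_1, ..., h_n>; None reports that H is trivial. *)
Definition shortest_element (A : choiceType) (hs : seq (word A))
    (answer : option (word A)) : Prop :=
  let H := generated [seq element_of h | h <- hs] in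
  match answer with
  | Some w =>
      [/\ H (element_of w), element_of w != 1%g
        & forall g : freeGroup A, H g -> g != 1%g ->
            word_length (element_of w) <= word_length g]
  | None => forall g : freeGroup A, H g -> g = 1%g
  end.

(* Deterministic multitape Turing machines over an input/output alphabet S.
   A cell is blank (None) or holds a symbol of S or an auxiliary work symbol. *)
Inductive move := MoveLeft | Stay | MoveRight.

Definition cell (S W : finType) : Type := option (S + W).

Record turing_machine (S : finType) : Type := TuringMachine {
  tm_state : finType;
  tm_work : finType;
  tm_extra : nat;  (* there are tm_extra.+1 tapes *)
  tm_start : tm_state;
  tm_halting : pred tm_state;
  tm_trans : tm_state -> {ffun 'I_tm_extra.+1 -> cell S tm_work} ->
             tm_state * {ffun 'I_tm_extra.+1 -> cell S tm_work * move} }.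

(* A two-way infinite tape, blank beyond the two lists: cells_left lists the
   cells strictly to the left of the head, nearest first, and cells_right those
   from the head rightwards, starting with the scanned cell. *)
Record tape (C : Type) : Type :=
  Tape { cells_left : seq (option C); cells_right : seq (option C) }.

Definition tape_read (C : Type) (t : tape C) : option C :=
  head None (cells_right t).

Definition tape_write (C : Type) (c : option C) (t : tape C) : tape C :=
  Tape (cells_left t) (c :: behead (cells_right t)).

Definition tape_move (C : Type) (d : move) (t : tape C) : tape C :=
  match d with
  | MoveLeft =>
      Tape (behead (cells_left t)) (head None (cells_left t) :: cells_right t)
  | Stay => t
  | MoveRight => Tape (tape_read t :: cells_left t) (behead (cells_right t))
  end.

(* The symbols from the head rightwards, up to the first blank. *)
Fixpoint up_to_blank (C : Type) (s : seq (option C)) : seq C :=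
  if s is Some c :: s' then c :: up_to_blank s' else [::].

Definition tape_output (C : Type) (t : tape C) : seq C :=
  up_to_blank (cells_right t).

Section Runs.
Variables (S : finType) (M : turing_machine S).

Definition config : Type :=
  (tm_state M * {ffun 'I_(tm_extra M).+1 -> tape (S + tm_work M)})%type.

(* A halted machine stays in its configuration. *)
Definition tm_step (c : config) : config :=
  if tm_halting c.1 then c else
  let: (q, act) := tm_trans c.1 [ffun i => tape_read (c.2 i)] in
  (q, [ffun i => tape_move (act i).2 (tape_write (act i).1 (c.2 i))]).

(* The input is on tape 0 with the head on its first symbol; the other tapes
   are blank. *)
Definition tm_init (input : seq S) : config :=
  (tm_start M,
   [ffun i => if i == ord0 then Tape [::] [seq Some (inl s) | s <- input]
              else Tape [::] [::]]).

Definition halts_with_output (input output : seq S) (t : nat) : Prop :=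
  let c := iter t tm_step (tm_init input) in
  tm_halting c.1 /\ tape_output (c.2 ord0) = [seq inl s | s <- output].

End Runs.

(* Membership in P for a search problem: a polynomial-time machine produces,
   on every instance x, some y related to x. *)
Definition in_P (S : finType) (X Y : Type)
    (encode_in : X -> seq S) (encode_out : Y -> seq S)
    (problem : X -> Y -> Prop) : Prop :=
  exists (M : turing_machine S) (p : {poly nat}), forall x : X,
  exists (y : Y) (t : nat),
    [/\ problem x y, halts_with_output M (encode_in x) (encode_out y) t
      & t <= (p.[size (encode_in x)])%R].

(* Words are written out letter by letter, each followed by an end marker. *)
Definition symbol (A : finType) : finType := (letter A + unit)%type.

Definition end_marker (A : finType) : symbol A := inr tt.

Definition encode_word (A : finType) (w : word A) : seq (symbol A) :=
  rcons [seq inl l | l <- w] (end_marker A).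

Definition encode_words (A : finType) (hs : seq (word A)) : seq (symbol A) :=
  flatten [seq encode_word h | h <- hs].

Definition encode_answer (A : finType) (answer : option (word A)) :
    seq (symbol A) :=
  if answer is Some w then encode_word w else [::].

(* The marker makes an empty generator count as input of length 1. *)
Lemma size_encode_words (A : finType) (hs : seq (word A)) :
  size (encode_words hs) = \sum_(h <- hs) (size h).+1.
Proof.
rewrite /encode_words; elim: hs => [|h hs IH]; first by rewrite big_nil.
by rewrite big_cons /= size_cat size_rcons size_map IH.
Qed.

(* Main.v *)
(* Cut the bouquet of circles labelled h_1, ..., h_n into its vertices, the
   positions in the input, and let E(p, q) be a set of reduced words of length
   at most 1, initially the labels of the edges from p to q.  Adding to E(p, r)
   the products of E(p, q) and E(q, r) of length at most 1 until nothing changes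
   only adds labels of paths of the bouquet; in the end, every reduced word that
   equals the label of a path is spelled by a path of E, letter by letter.  So H
   is the set of the reduced words spelled by the closed paths of E at the base
   vertex, and a breadth-first search on pairs (vertex, next letter) that never
   lets a letter be followed by its inverse finds a shortest nonempty one; it
   has at most as many letters as the input.

   A Turing machine keeps E and the search data in a square table written row by
   row on one tape.  Each cell carries marks telling which of five pointers
   designate its row and its column, so that testing and modifying the cell in
   row i and column j, or moving a pointer to the next vertex, is one pass of a
   finite transducer over the tape.  Programs are built from such passes by
   sequencing and by loops of a pointer over all vertices; since nothing else
   loops, they run in polynomial time whatever they compute. *)

From HB Require Import structures.
Require Import Defs.
From mathcomp Require Import all_boot all_order all_algebra.
From mathcomp Require Import zify.

Set Implicit Arguments.
Unset Strict Implicit.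
Unset Printing Implicit Defensive.

(** * Structured programs for Turing machines *)

(** Stallings folding would identify vertices, so that the graph itself changes during the
    computation; saturation keeps the vertices fixed and only enlarges sets of labels. As the basis
    is fixed, such a set, or a table of continuations indexed by letters, is an element of a finite
    type and fits in one cell. Growth is monotone, so any number of rounds exceeding the number of
    triples (vertex, vertex, label) reaches the fixed point without a test for termination: this is
    what makes loops over the vertices sufficient. Saturation takes three pointers for p, q, r and
    two more to count rounds, whence five in all. The search runs backwards from the base vertex and
    records, for a vertex and a first letter, which letter may follow and at which vertex. The
    answer is then read off forwards from the base vertex and emitted letter by letter, without ever
    storing a word. *)

Section Tapes.
Variable C : Type.
Implicit Types t u : tape C.

(** A head that visits cells beyond the two lists leaves explicit [None] entries there, so tapes are
    compared through what [nth] reads, not as pairs of lists. *)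
Definition tape_eq t u : Prop :=
  nth None (cells_left t) =1 nth None (cells_left u) /\
  nth None (cells_right t) =1 nth None (cells_right u).

Lemma tape_eq_sym t u : tape_eq t u -> tape_eq u t.
Proof. by case=> l r; split=> i; rewrite ?l ?r. Qed.

Lemma tape_eq_trans t u w : tape_eq t u -> tape_eq u w -> tape_eq t w.
Proof. by case=> l r [l' r']; split=> i; rewrite ?l ?r. Qed.

Lemma tape_read_eq t u : tape_eq t u -> tape_read t = tape_read u.
Proof. by case=> _ r; rewrite /tape_read -!nth0. Qed.

Lemma tape_write_eq c t u :
  tape_eq t u -> tape_eq (tape_write c t) (tape_write c u).
Proof. by case=> l r; split=> //= -[|i] //=; rewrite !nth_behead. Qed.

Lemma tape_move_eq d t u : tape_eq t u -> tape_eq (tape_move d t) (tape_move d u).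
Proof.
move=> tu; have [l r] := tu; case: d => //=; split=> //= i.
- by rewrite !nth_behead.
- by case: i => [|i] //=; rewrite -!nth0.
- by case: i => [|i] //=; apply: tape_read_eq.
- by rewrite !nth_behead.
Qed.

Lemma tape_rewrite_eq t : tape_eq (tape_write (tape_read t) t) t.
Proof. by split=> //= -[|i] /=; rewrite ?nth_behead // -nth0. Qed.

Lemma up_to_blank_eq (r s : seq (option C)) :
  nth None r =1 nth None s -> up_to_blank r = up_to_blank s.
Proof.
elim: r s => [|[c|] r IHr] [|[d|] s] //= rs; try by have := rs 0.
by have [->] := rs 0; congr cons; apply: IHr => i; have := rs i.+1.
Qed.

Lemma up_to_blank_Some (s : seq C) : up_to_blank (map Some s) = s.
Proof. by elim: s => //= x s ->. Qed.

End Tapes.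

Section Programs.
Variables S W V : finType.
Notation tp := (tape (S + W)).

Definition tapes : Type := (tp * tp * tp)%type.

Definition get (ts : tapes) (i : 'I_3) : tp :=
  match val i with 0 => ts.1.1 | 1 => ts.1.2 | _ => ts.2 end.

Definition set (ts : tapes) (i : 'I_3) (t : tp) : tapes :=
  match val i with
  | 0 => (t, ts.1.2, ts.2) | 1 => (ts.1.1, t, ts.2) | _ => (ts.1.1, ts.1.2, t)
  end.

Lemma get_set ts i t j : get (set ts i t) j = if j == i then t else get ts j.
Proof. by case: i j => [[|[|[|i]]] //= ?] [[|[|[|j]]] //= ?]. Qed.

Lemma set_set ts i t u : set (set ts i t) i u = set ts i u.
Proof. by case: i => [[|[|[|i]]] //= ?]. Qed.

Lemma set_get ts i : set ts i (get ts i) = ts.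
Proof. by case: ts => -[a b] c; case: i => [[|[|[|i]]] //= ?]. Qed.

Lemma set_comm ts i j t u : i != j -> set (set ts i t) j u = set (set ts j u) i t.
Proof. by case: i j => [[|[|[|i]]] //= ?] [[|[|[|j]]] //= ?]. Qed.

(** [V] is the memory of the finite control. A loop is of the do-while kind: its test looks at the
    memory after the body has run. *)
Inductive prog : Type :=
| Step (i : 'I_3) (f : V -> cell S W -> V * cell S W * move)
| Seq (p q : prog)
| Loop (p : prog) (again : pred V).

Definition step_tape (a : cell S W * move) (t : tp) : tp :=
  tape_move a.2 (tape_write a.1 t).

(* [exec p n c d]: in at most [n] steps, [p] leads from [c] to a configuration
   that agrees with [d] up to blank cells at the two ends of each tape. *)
Inductive exec : prog -> nat -> V * tapes -> V * tapes -> Prop :=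
| exec_step i f v ts v' c d t n :
    f v (tape_read (get ts i)) = (v', c, d) ->
    tape_eq t (step_tape (c, d) (get ts i)) -> 0 < n ->
    exec (Step i f) n (v, ts) (v', set ts i t)
| exec_seq p q m1 m2 n c1 c2 c3 :
    exec p m1 c1 c2 -> exec q m2 c2 c3 -> m1 + m2 <= n ->
    exec (Seq p q) n c1 c3
| exec_stop p (b : pred V) m n c1 c2 :
    exec p m c1 c2 -> ~~ b c2.1 -> m <= n -> exec (Loop p b) n c1 c2
| exec_next p (b : pred V) m1 m2 n c1 c2 c3 :
    exec p m1 c1 c2 -> b c2.1 -> exec (Loop p b) m2 c2 c3 -> m1 + m2 <= n ->
    exec (Loop p b) n c1 c3.

Lemma exec_leq p m n c d : exec p m c d -> m <= n -> exec p n c d.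
Proof.
case=> [i f v ts v' a b t k fE tE k0|p1 q1 m1 m2 k c1 c2 c3 e1 e2 mk
  |p1 b k1 k c1 c2 e nb kk|p1 b m1 m2 k c1 c2 c3 e1 bb e2 mk] kn.
- by apply: exec_step fE tE _; apply: leq_trans kn.
- by apply: exec_seq e1 e2 _; apply: leq_trans kn.
- by apply: exec_stop e nb _; apply: leq_trans kn.
by apply: exec_next e1 bb e2 _; apply: leq_trans kn.
Qed.

Fixpoint state (p : prog) : finType :=
  match p with
  | Step _ _ => unit
  | Seq p q => (state p + state q)%type
  | Loop p _ => state p
  end.

Fixpoint start (p : prog) : state p :=
  match p return state p with
  | Step _ _ => tt
  | Seq p q => inl (start p)
  | Loop p _ => start p
  end.

Definition action : Type := ('I_3 * (cell S W * move))%type.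

(* [None] in place of a state: the program terminates. *)
Fixpoint succ_state (p : prog) {struct p} :
    state p -> V -> ('I_3 -> cell S W) -> option (state p) * V * action :=
  match p return state p -> V -> ('I_3 -> cell S W) ->
                 option (state p) * V * action with
  | Step i f => fun _ v r => let: (v', c, d) := f v (r i) in (None, v', (i, (c, d)))
  | Seq p q => fun s v r =>
      match s with
      | inl s => let: (o, v', a) := @succ_state p s v r in
                 (Some (if o is Some s' then inl s' else inr (start q)), v', a)
      | inr s => let: (o, v', a) := @succ_state q s v r in (omap inr o, v', a)
      end
  | Loop p b => fun s v r =>
      let: (o, v', a) := @succ_state p s v r in
      (if o is Some s' then Some s'
       else if b v' then Some (start p) else None, v', a)
  end.

Variable v0 : V.

Definition machine (p : prog) : turing_machine S :=
  @TuringMachine S (option (state p) * V)%type W 2 (Some (start p), v0)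
    (fun q => q.1 == None)
    (fun q r =>
       if q.1 is Some s then
         let: (o, v, a) := succ_state s q.2 r in
         ((o, v), [ffun j => if j == a.1 then a.2 else (r j, Stay)])
       else (q, [ffun j => (r j, Stay)])).

(** Induction on the execution needs [p] as a part of a larger program [P]: [emb] places its states
    among those of [P], and [exit] gives the state of [P] entered when [p] terminates. It depends on
    the memory because an enclosing loop decides from the memory whether to start again. *)
Lemma machine_run (P p : prog) n c d (emb : state p -> state P)
    (exit : V -> option (state P)) :
  exec p n c d ->
  (forall s v r, succ_state (emb s) v r =
     let: (o, v', a) := succ_state s v r in
     (if o is Some s' then Some (emb s') else exit v', v', a)) ->
  forall C : config (machine P),
    C.1 = (Some (emb (start p)), c.1) ->
    (forall i, tape_eq (C.2 i) (get c.2 i)) ->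
  exists t (D : config (machine P)),
    [/\ t <= n, iter t (@tm_step _ (machine P)) C = D,
        D.1 = (exit d.1, d.1) & forall i, tape_eq (D.2 i) (get d.2 i)].
Proof.
move=> e; elim: e emb exit => {p n c d}.
- move=> i f v ts v' a d t n fE tE n0 emb exit embE C C1 C2.
  pose rd : {ffun 'I_3 -> cell S W} := [ffun i => tape_read (C.2 i)].
  have rdE : rd i = tape_read (get ts i) by rewrite ffunE; apply/tape_read_eq/C2.
  have stepE : tm_step C = ((exit v', v'), [ffun j => step_tape
      (if j == i then (a, d) else (rd j, Stay)) (C.2 j)]).
    rewrite /tm_step C1 /= embE /= -/rd rdE fE /=; congr pair.
    by apply/ffunP=> j; rewrite !ffunE.
  exists 1, (tm_step C); split=> //; rewrite stepE // => j.
  rewrite ffunE get_set; case: eqP => [->|_].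
    apply: tape_eq_trans (tape_eq_sym tE).
    by apply/tape_move_eq/tape_write_eq/C2.
  by rewrite ffunE; apply: tape_eq_trans (tape_rewrite_eq _) (C2 j).
- move=> p q m1 m2 n c1 c2 c3 _ IH1 _ IH2 le_n emb exit embE C C1 C2.
  have [|t1 [D1 [t1m1 D1E D11 D12]]] :=
    IH1 (emb \o inl) (fun=> Some (emb (inr (start q)))) _ C C1 C2.
    by move=> s v r; rewrite embE /=; case: (succ_state s v r) => -[[]].
  have [|t2 [D2 [t2m2 D2E D21 D22]]] := IH2 (emb \o inr) exit _ D1 D11 D12.
    by move=> s v r; rewrite embE /=; case: (succ_state s v r) => -[[]].
  exists (t2 + t1), D2; split=> //; last by rewrite iterD D1E.
  by rewrite addnC (leq_trans _ le_n) // leq_add.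
- move=> p b m n c1 c2 _ IH nb le_n emb exit embE C C1 C2.
  have [|t [D [tm DE D1 D2]]] :=
    IH emb (fun v => if b v then Some (emb (start p)) else exit v) _ C C1 C2.
    by move=> s v r; rewrite embE /=; case: (succ_state s v r) => -[[s'|] v'] a //=; case: ifP.
  exists t, D; split=> //; first exact: leq_trans le_n.
  by rewrite D1 (negPf nb).
- move=> p b m1 m2 n c1 c2 c3 _ IH1 bc _ IH2 le_n emb exit embE C C1 C2.
  have [|t1 [D1 [t1m1 D1E D11 D12]]] :=
    IH1 emb (fun v => if b v then Some (emb (start p)) else exit v) _ C C1 C2.
    by move=> s v r; rewrite embE /=; case: (succ_state s v r) => -[[s'|] v'] a //=; case: ifP.
  rewrite bc in D11.
  have [t2 [D2 [t2m2 D2E D21 D22]]] := IH2 emb exit embE D1 D11 D12.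
  exists (t2 + t1), D2; split=> //; last by rewrite iterD D1E.
  by rewrite addnC (leq_trans _ le_n) // leq_add.
Qed.

Lemma machine_halts p n (input output : seq S) l r v ts :
  exec p n (v0, (Tape [:: None] [seq Some (inl s) | s <- input],
                 Tape [:: None] [::], Tape [:: None] [::]))
           (v, ts) ->
  get ts ord0 = Tape l r -> up_to_blank r = [seq inl s | s <- output] ->
  exists2 t, t <= n & halts_with_output (machine p) input output t.
Proof.
move=> e t0 rE.
have [s w x||i|t [D [tn DE D1 D2]]] :=
    machine_run (P := p) (emb := id) (exit := fun=> None) e _ (C := tm_init (machine p) input).
- by case: (succ_state s w x) => -[[]].
- by [].
- by rewrite ffunE; case: i => [[|[|[|i]]] //= ?]; split=> // -[|[]].
exists t => //; rewrite /halts_with_output DE D1; split=> //.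
by have [_] := D2 ord0; rewrite t0 => /up_to_blank_eq; rewrite /tape_output rE.
Qed.

End Programs.

(** * Passes over a tape *)

Section Passes.
Variables S W Q : finType.
Notation symb := (S + W)%type.

(* A flag controlling the innermost loop, a symbol in transit between two
   tapes, and the memory proper. *)
Notation memory := (bool * option symb * Q)%type.

Notation prog := (prog S W memory).
Notation tapes := (tapes S W).
Implicit Types (v : memory) (ts : tapes) (s : seq symb) (i j : 'I_3).

(* Every tape at rest has a blank to the left of its head. *)
Definition rest_tape (l : seq (option symb)) s : tape symb :=
  Tape (None :: l) (map Some s).

Definition going v : bool := v.1.1.

Definition scan i (g : Q -> symb -> Q * symb) : prog :=
  Loop (Step i (fun v (c : cell S W) =>
    if c is Some x then
      let: (q, y) := g v.2 x in (true, v.1.2, q, Some y, MoveRight)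
    else (false, v.1.2, v.2, None, MoveLeft))) going.

Definition rewind i : prog :=
  Loop (Step i (fun v (c : cell S W) =>
    if c is Some x then (true, v.1.2, v.2, c, MoveLeft)
    else (false, v.1.2, v.2, c, MoveRight))) going.

Fixpoint mealy (g : Q -> symb -> Q * symb) (q : Q) s : Q * seq symb :=
  if s is x :: s' then
    let: (q1, y) := g q x in
    let: (q2, ys) := mealy g q1 s' in (q2, y :: ys)
  else (q, [::]).

Lemma mealy_cons g q x s :
  mealy g q (x :: s) =
  let: (q1, y) := g q x in let: (q2, t) := mealy g q1 s in (q2, y :: t).
Proof. by []. Qed.

Lemma mealy_cat g q s1 s2 :
  mealy g q (s1 ++ s2) =
  let: (q1, t1) := mealy g q s1 in
  let: (q2, t2) := mealy g q1 s2 in (q2, t1 ++ t2).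
Proof.
elim: s1 q => [|x s1 IH] q /=; first by case: (mealy g q s2).
case: (g q x) => q1 y; rewrite IH; case: (mealy g q1 s1) => q2 t1.
by case: (mealy g q2 s2).
Qed.

Lemma size_mealy g q s : size (mealy g q s).2 = size s.
Proof.
elim: s q => //= x s IH q; case: (g q x) => q1 y; have := IH q1.
by case: (mealy g q1 s) => q2 t /= ->.
Qed.

(** [L] lists the cells from the scanned one leftwards. Describing the head by [head] and [behead]
    of [L] also covers an empty [s], where the head already stands on the blank. *)
Lemma rewindP i s l r v ts t L :
  L = rev (map Some s) ++ None :: l ->
  get ts i = Tape (behead L) (head None L :: r) ->
  tape_eq t (Tape (None :: l) (map Some s ++ r)) ->
  exec (rewind i) (size s).+1 (v, ts) (false, v.1.2, v.2, set ts i t).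
Proof.
elim/last_ind: s L r v ts => [|s x IH] L r v ts ->.
  move=> tE te; apply: exec_stop (leqnn 1) => //.
  by apply: exec_step; rewrite ?tE.
rewrite map_rcons rev_rcons size_rcons /= => tE te.
set L' := rev (map Some s) ++ None :: l.
pose ts' := set ts i (Tape (behead L') (head None L' :: Some x :: r)).
apply: (@exec_next _ _ _ _ _ 1 (size s).+1 _ _ (true, v.1.2, v.2, ts')) => //.
  by apply: exec_step; rewrite ?tE.
have -> : set ts i t = set ts' i t by rewrite set_set.
apply: (IH L' (Some x :: r) (true, v.1.2, v.2)) => //.
  by rewrite get_set eqxx.
by rewrite -cats1 -catA in te.
Qed.

Lemma tape_eq_rcons_None (l r : seq (option symb)) :
  tape_eq (Tape l r) (Tape l (r ++ [:: None])).
Proof.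
by split=> //= k; rewrite nth_cat; case: ltnP => // /(nth_default None) ->;
  case: (k - size r) => [|[]].
Qed.

Lemma rewind_setP i s l v ts :
  let L := rev (map Some s) ++ None :: l in
  exec (rewind i) (size s).+1
    (v, set ts i (Tape (behead L) [:: head None L; None]))
    (false, v.1.2, v.2, set ts i (rest_tape l s)).
Proof.
move=> L; rewrite -(set_set ts i (Tape (behead L) [:: head None L; None])
  (rest_tape l s)).
apply: (rewindP (r := [:: None])) => //; first by rewrite get_set eqxx.
exact: tape_eq_rcons_None.
Qed.

Lemma scanP i g s l v ts :
  get ts i = Tape l (map Some s) ->
  let: (q, s') := mealy g v.2 s in
  let L := rev (map Some s') ++ l in
  exec (scan i g) (size s).+1 (v, ts)
    (false, v.1.2, q, set ts i (Tape (behead L) [:: head None L; None])).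
Proof.
elim: s l v ts => [|x s IH] l v ts tE /=.
  apply: exec_stop (leqnn 1) => //.
  by apply: exec_step; rewrite ?tE.
case gE: (g v.2 x) => [q y].
pose ts' := set ts i (Tape (Some y :: l) (map Some s)).
have := IH (Some y :: l) (true, v.1.2, q) ts'; rewrite get_set eqxx.
move=> /(_ erefl) /=; case: (mealy g q s) => q' s' /=.
rewrite set_set rev_cons cat_rcons => e.
apply: (@exec_next _ _ _ _ _ 1 _ _ _ (true, v.1.2, q, ts')) e _ => //=.
by apply: exec_step; rewrite ?tE /= ?gE.
Qed.

Definition pass i g : prog := Seq (scan i g) (rewind i).

Definition pass_cost n := n.*2.+2.

Lemma passP i g s l v ts :
  get ts i = rest_tape l s ->
  let: (q, s') := mealy g v.2 s in
  exec (pass i g) (pass_cost (size s)) (v, ts)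
    (false, v.1.2, q, set ts i (rest_tape l s')).
Proof.
move=> tE; have := scanP g v tE; have := size_mealy g v.2 s.
case: (mealy g v.2 s) => q s' /= sz e.
by apply: exec_seq e (rewind_setP i s' l (false, v.1.2, q) ts) _;
  rewrite sz /pass_cost; lia.
Qed.

(** A [Step] acts on a single tape, so each symbol travels through the memory in two steps; at the
    blank of tape [i] nothing is in transit and the second step leaves tape [j] alone. *)
Definition send i j (e : Q -> symb -> symb) : prog :=
  Loop (Seq
    (Step i (fun v (c : cell S W) =>
       if c is Some x then (true, Some (e v.2 x), v.2, c, MoveRight)
       else (false, None, v.2, None, MoveLeft)))
    (Step j (fun v (c : cell S W) =>
       if v.1.2 is Some y then (v, Some y, MoveRight) else (v, c, Stay)))) going.

Definition transduce i j e : prog := Seq (send i j e) (rewind i).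

Definition transduce_cost n := (n * 3).+3.

Lemma sendP i j e s l L v ts :
  i != j -> get ts i = Tape l (map Some s) -> get ts j = Tape L [::] ->
  let L' := rev (map Some s) ++ l in
  exec (send i j e) (size s).*2.+2 (v, ts)
    (false, None, v.2,
     set (set ts j (Tape (rev (map (Some \o e v.2) s) ++ L) [::]))
       i (Tape (behead L') [:: head None L'; None])).
Proof.
move=> ij; elim: s l L v ts => [|x s IH] l L v ts ti tj /=.
  apply: exec_stop (leqnn 2) => //.
  pose ts' := set ts i (Tape (behead l) [:: head None l; None]).
  apply: (@exec_seq _ _ _ _ _ 1 1 _ _ (false, None, v.2, ts')) => //.
    by apply: exec_step; rewrite ?ti.
  rewrite set_comm 1?eq_sym //.
  by apply: exec_step => //=; rewrite get_set eq_sym (negPf ij) tj; split=> // -[|[]].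
pose ts1 := set ts i (Tape (Some x :: l) (map Some s)).
pose y := e v.2 x.
pose ts2 := set ts1 j (Tape (Some y :: L) [::]).
have := IH (Some x :: l) (Some y :: L) (true, Some y, v.2) ts2.
rewrite !get_set (negPf ij) !eqxx.
move=> /(_ erefl erefl) /=; set A := Tape (rev _ ++ _ :: L) _; set B := Tape (behead _) _.
have -> : set (set ts2 j A) i B = set (set ts j A) i B.
  by rewrite /ts2 set_set /ts1 (set_comm ts _ _ ij) set_set.
rewrite !rev_cons !cat_rcons -/A -/B => h.
apply: (@exec_next _ _ _ _ _ 2 _ _ _ (true, Some y, v.2, ts2)) h _ => //=.
apply: (@exec_seq _ _ _ _ _ 1 1 _ _ (true, Some y, v.2, ts1)) => //.
  by apply: exec_step; rewrite ?ti.
by apply: exec_step; rewrite /= ?get_set 1?eq_sym ?(negPf ij) ?tj.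
Qed.

Lemma transduceP i j e s l L v ts :
  i != j -> get ts i = rest_tape l s -> get ts j = Tape L [::] ->
  exec (transduce i j e) (transduce_cost (size s)) (v, ts)
    (false, None, v.2, set ts j (Tape (rev (map (Some \o e v.2) s) ++ L) [::])).
Proof.
move=> ij ti tj; have := sendP e v ij ti tj; set ts' := set ts j _ => h.
have t'i : get ts' i = rest_tape l s by rewrite get_set (negPf ij).
rewrite -(set_get ts' i) t'i.
by apply: exec_seq h (rewind_setP i s l (false, None, v.2) ts') _;
  rewrite /transduce_cost; lia.
Qed.

Definition back i : prog := Step i (fun v c => (v, c, MoveLeft)).

Lemma back_rewindP i s l v ts :
  get ts i = Tape (rev (map Some s) ++ None :: l) [::] ->
  exec (Seq (back i) (rewind i)) (size s).+2 (v, ts)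
    (false, v.1.2, v.2, set ts i (rest_tape l s)).
Proof.
move=> ti; set L := rev _ ++ _ in ti.
pose ts' := set ts i (Tape (behead L) [:: head None L; None]).
apply: (@exec_seq _ _ _ _ _ 1 (size s).+1 _ _ (v, ts')) => //.
  by apply: exec_step; rewrite ?ti.
exact: rewind_setP.
Qed.

Definition write i (h : Q -> option symb) : prog :=
  Step i (fun v c => if h v.2 is Some y then (v, Some y, MoveRight) else (v, c, Stay)).

Lemma writeP i h L v ts :
  get ts i = Tape L [::] ->
  exec (write i h) 1 (v, ts)
    (v, set ts i (Tape (if h v.2 is Some y then Some y :: L else L) [::])).
Proof.
move=> ti; pose a := if h v.2 is Some y then (v, Some y, MoveRight) else (v, None, Stay).
apply: (@exec_step _ _ _ i _ v ts v a.1.2 a.2) => //; rewrite ti /a;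
  by case: (h v.2) => //=; split=> // -[|[]].
Qed.

Definition update (f : Q -> Q) : prog :=
  Step ord0 (fun v c => (v.1, f v.2, c, Stay)).

Lemma updateP f v ts : exec (update f) 1 (v, ts) (v.1, f v.2, ts).
Proof.
rewrite -{2}(set_get ts ord0); apply: exec_step => //.
exact/tape_eq_sym/tape_rewrite_eq.
Qed.

End Passes.

(** * Programs on a square table *)

Section TablePrograms.
Variables S C U : finType.

(* A cell of the table, stored row by row, holds its contents, whether it lies
   in the first row and in the first column, and for each of five pointers
   whether the pointer designates its row and its column. *)
Notation table_cell := (C * (bool * bool) * {ffun 'I_5 -> bool * bool})%type.
Notation symb := (S + table_cell)%type.

(* Three scratch bits for the passes that move pointers, then the registers. *)
Notation memory := (bool * bool * bool * U)%type.

Inductive table_prog : Type :=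
| Op (i j : 'I_5) (f : U -> C -> U * C)
| Emit (e : U -> option S)
| Then (p q : table_prog)
| For (i : 'I_5) (p : table_prog).

Definition tstate m : Type :=
  (U * {ffun 'I_m.+1 * 'I_m.+1 -> C} * seq S)%type.

Definition repoint (T : Type) (rho : 'I_5 -> T) (i : 'I_5) (a : T) : 'I_5 -> T :=
  fun j => if j == i then a else rho j.

Definition do_op m (f : U -> C -> U * C) (x : 'I_m.+1 * 'I_m.+1)
    (h : tstate m) : tstate m :=
  let: (u, c) := f h.1.1 (h.1.2 x) in
  (u, [ffun y => if y == x then c else h.1.2 y], h.2).

Definition do_emit m (e : U -> option S) (h : tstate m) : tstate m :=
  (h.1, if e h.1.1 is Some s then rcons h.2 s else h.2).

Fixpoint sem m (p : table_prog) (rho : 'I_5 -> 'I_m.+1) (h : tstate m) : tstate m :=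
  match p with
  | Op i j f => do_op f (rho i, rho j) h
  | Emit e => do_emit e h
  | Then p q => sem q rho (sem p rho h)
  | For i p => foldl (fun h a => sem p (repoint rho i a) h) h (enum 'I_m.+1)
  end.

(* Loop pointers decrease inwards; those below [n] start and end at 0. *)
Fixpoint nested n (p : table_prog) : bool :=
  match p with
  | Then p q => nested n p && nested n q
  | For i p => (i < n) && nested i p
  | _ => true
  end.

Fixpoint cost (p : table_prog) (m : nat) : nat :=
  match p with
  | Op _ _ _ => pass_cost (m * m)
  | Emit _ => 1
  | Then p q => cost p m + cost q m
  | For _ p => m * (cost p m + (1 + pass_cost (m * m))) + pass_cost (m * m)
  end.

Definition op_pass (i j : 'I_5) (f : U -> C -> U * C) (q : memory) (x : symb) :
    memory * symb :=
  if x is inr (c, st, mk) then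
    if (mk i).1 && (mk j).2 then
      let: (u, c') := f q.2 c in (q.1, u, inr (c', st, mk))
    else (q, x)
  else (q, x).

(* The scratch bits are the column mark of the previous cell, the new mark of
   the current row and the old mark of the last row seen. *)
Definition shift_pass (i : 'I_5) (q : memory) (x : symb) : memory * symb :=
  if x is inr (c, (fr, fc), mk) then
    let: (col, new, old, u) := q in
    let new' := if fc then old else new in
    ((mk i).2, new', (mk i).1, u,
     inr (c, (fr, fc),
          [ffun k => if k == i then (new', if fc then false else col) else mk k]))
  else (q, x).

Definition reset_pass (i : 'I_5) (q : memory) (x : symb) : memory * symb :=
  if x is inr (c, st, mk) then
    (q, inr (c, st, [ffun k => if k == i then st else mk k]))
  else (q, x).

Definition tape2 : 'I_3 := @Ordinal 3 2 isT.

Fixpoint compile (p : table_prog) : prog S table_cell (bool * option symb * memory)%type :=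
  match p with
  | Op i j f => pass tape2 (op_pass i j f)
  | Emit e => write ord0 (fun q => omap inl (e q.2))
  | Then p q => Seq (compile p) (compile q)
  | For i p =>
      Seq (Loop (Seq (compile p)
                  (Seq (update _ _ (fun q => (false, false, false, q.2)))
                       (pass tape2 (shift_pass i))))
                (fun v => ~~ v.2.1.2))
          (pass tape2 (reset_pass i))
  end.

(** Pointers range over [nat], not over vertices: after its last shift a loop pointer is [m.+1] and
    marks no cell until it is reset. *)
Definition table_entry m (rho : 'I_5 -> nat) (T : 'I_m.+1 * 'I_m.+1 -> C)
    (x : 'I_m.+1 * 'I_m.+1) : symb :=
  inr (T x, (x.1 == 0 :> nat, x.2 == 0 :> nat),
       [ffun k => (rho k == x.1, rho k == x.2)]).

Definition cells m : seq ('I_m.+1 * 'I_m.+1) :=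
  [seq (a, b) | a <- enum 'I_m.+1, b <- enum 'I_m.+1].

Definition table m rho (T : 'I_m.+1 * 'I_m.+1 -> C) : seq symb :=
  map (table_entry rho T) (cells m).

Lemma mem_cells m x : x \in cells m.
Proof. by case: x => a b; apply/allpairsP; exists (a, b); rewrite !mem_enum. Qed.

Lemma uniq_cells m : uniq (cells m).
Proof. by apply: allpairs_uniq; rewrite ?enum_uniq // => -[] ? ? []. Qed.

Lemma size_table m rho (T : 'I_m.+1 * 'I_m.+1 -> C) : size (table rho T) = m.+1 * m.+1.
Proof. by rewrite size_map size_allpairs size_enum_ord. Qed.

Lemma eq_table m rho1 rho2 (T : 'I_m.+1 * 'I_m.+1 -> C) :
  rho1 =1 rho2 -> table rho1 T = table rho2 T.
Proof.
move=> rr; apply: eq_map => x; congr (inr (_, _)).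
by apply/ffunP=> k; rewrite !ffunE rr.
Qed.

Lemma mealy_op m i j f q (rho : 'I_5 -> 'I_m.+1) (T : {ffun 'I_m.+1 * 'I_m.+1 -> C}) :
  let x := (rho i, rho j) in
  mealy (op_pass i j f) q (table (fun k => rho k) T) =
  let: (u, c) := f q.2 (T x) in
  (q.1, u, table (fun k => rho k) [ffun y => if y == x then c else T y]).
Proof.
move=> x; case fE: (f _ _) => [u c]; rewrite /table.
set T' := finfun _; pose E (T : 'I_m.+1 * 'I_m.+1 -> C) := table_entry (fun k => rho k : nat) T.
have offx y : y != x -> op_pass i j f ^~ (E T y) =1 fun q => (q, E T' y).
  rewrite /x; case: y => y1 y2 yx q1; rewrite /= !ffunE /=.
  have -> : (rho i == y1 :> nat) && (rho j == y2 :> nat) = false.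
    by apply/andP=> -[/eqP/val_inj r1 /eqP/val_inj r2]; rewrite -r1 -r2 eqxx in yx.
  by rewrite /E /table_entry ffunE (negPf yx).
have off s q1 : x \notin s -> mealy (op_pass i j f) q1 (map (E T) s) = (q1, map (E T') s).
  elim: s => // y s IH; rewrite inE negb_or eq_sym => /andP[yx xs].
  by rewrite map_cons mealy_cons offx // IH.
have : x \in cells m by apply: mem_cells.
move: (cells m) (uniq_cells m) => s us xs; move: us.
case/splitPr: xs => s1 s2; rewrite uniq_catC /= mem_cat negb_or => /andP[/andP[x2 x1] _].
rewrite !map_cat mealy_cat off //= !ffunE !eqxx /= fE off //.
by rewrite /E /table_entry ffunE eqxx.
Qed.

(** The new column mark of a cell is the old one of its left neighbour; the new row mark of a row is
    the old one of the row above, picked up in column 0 and carried along the row. At [b0 = 0] only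
    [old] is constrained, as the first cell overwrites the other two bits; that row must be nonempty
    for [old] to be refreshed. *)
Lemma mealy_shift_row m i (rho : 'I_5 -> nat) (T : 'I_m.+1 * 'I_m.+1 -> C) (a : 'I_m.+1)
    (bs : seq 'I_m.+1) b0 col new old u :
  let rho' := repoint rho i (rho i).+1 in
  map val bs = iota b0 (size bs) ->
  (if b0 == 0 then old = (rho' i == a) /\ bs != [::]
   else [/\ col = (rho' i == b0), new = (rho' i == a) & old = (rho i == a)]) ->
  exists q, mealy (shift_pass i) (col, new, old, u)
              (map (table_entry rho T) (map (pair a) bs)) =
            (q, rho i == a :> nat, u, map (table_entry rho' T) (map (pair a) bs)).
Proof.
move=> rho'; have r'i : rho' i = (rho i).+1 by rewrite /rho' /repoint eqxx.
elim: bs b0 col new old => [|b bs IH] b0 col new old /=.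
  by case: eqP => [_ _ [_]|_ _ [_ _ ->]] //; exists (col, new).
case=> bE bsE H.
pose new' := if b == 0 :> nat then old else new.
have new'E : new' = (rho' i == a).
  by rewrite /new' bE; move: H; case: eqP => _ []; rewrite // => ->.
have [|q IHq] := IH b0.+1 (rho i == b) new' (rho i == a) bsE.
  by rewrite /= new'E r'i bE eqSS.
exists q; rewrite !ffunE /= -/new' IHq; congr (_, _ :: _).
congr (inr (_, _)); apply/ffunP=> k; rewrite !ffunE.
case: eqP => [->|/eqP ki]; last by rewrite /rho' /repoint (negPf ki).
rewrite new'E; congr pair; rewrite bE r'i; move: H; case: eqP => [-> //|_ [-> _ _]].
by rewrite r'i.
Qed.

Lemma enum_ord_iota m : map val (enum 'I_m.+1) = iota 0 (size (enum 'I_m.+1)).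
Proof. by rewrite val_enum_ord size_enum_ord. Qed.

Lemma mealy_shift m i (rho : 'I_5 -> nat) (T : 'I_m.+1 * 'I_m.+1 -> C) u :
  exists q, mealy (shift_pass i) (false, false, false, u) (table rho T) =
            (q, rho i == m, u, table (repoint rho i (rho i).+1) T).
Proof.
rewrite /table /cells; set rho' := repoint _ _ _.
have r'i : rho' i = (rho i).+1 by rewrite /rho' /repoint eqxx.
suff H (s : seq 'I_m.+1) a0 col new :
    map val s = iota a0 (size s) ->
    let f := fun r => map (table_entry r T) [seq (a, b) | a <- s, b <- enum 'I_m.+1] in
    exists q, mealy (shift_pass i) (col, new, rho' i == a0, u) (f rho) =
              (q, rho' i == a0 + size s, u, f rho').
  have [|q] := H (enum 'I_m.+1) 0 false false; first exact: enum_ord_iota.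
  by rewrite size_enum_ord r'i => ->; exists q.
elim: s a0 col new => [|a s IH] a0 col new /=.
  by rewrite addn0; exists (col, new).
case=> aE sE; rewrite !map_cat mealy_cat.
have [|q1] := @mealy_shift_row m i rho T a (enum 'I_m.+1) 0 col new (rho' i == a0) u
  (enum_ord_iota m).
  by rewrite /= aE; split=> //; rewrite -size_eq0 size_enum_ord.
rewrite -/rho' => ->; case: q1 => col1 new1.
have [q2] := IH a0.+1 col1 new1 sE.
by rewrite r'i eqSS aE addSnnS => ->; exists q2.
Qed.

Lemma mealy_reset m i q (rho : 'I_5 -> nat) (T : 'I_m.+1 * 'I_m.+1 -> C) :
  mealy (reset_pass i) q (table rho T) = (q, table (repoint rho i 0) T).
Proof.
rewrite /table; elim: (cells m) => //= x s ->; congr (_, inr (_, _) :: _).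
by apply/ffunP=> k; rewrite !ffunE /repoint; case: eqP => //; rewrite !(eq_sym 0).
Qed.

(** On tape 0 the output so far follows a blank, with the head at its end; [L] is what lies to the
    left of that blank, namely the consumed input. The blank is where the final rewind stops. *)
Definition represents L m (rho : 'I_5 -> nat) (h : tstate m)
    (c : bool * option symb * memory * tapes S table_cell) : Prop :=
  [/\ c.1.2.2 = h.1.1,
      get c.2 ord0 = Tape (rev [seq Some (inl s) | s <- h.2] ++ None :: L) [::]
    & get c.2 tape2 = rest_tape [::] (table rho h.1.2)].

Lemma pass_table L m (rho rho' : 'I_5 -> nat) (h h' : tstate m) c g :
  represents L rho h c ->
  (exists b, mealy g c.1.2 (table rho h.1.2) = (b, h'.1.1, table rho' h'.1.2)) ->
  h'.2 = h.2 ->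
  exists c', [/\ exec (pass tape2 g) (pass_cost (m.+1 * m.+1)) c c',
                 represents L rho' h' c'
               & c'.1.2 = (mealy g c.1.2 (table rho h.1.2)).1].
Proof.
case: c => v ts [_ t0 t2] [b gE] oE.
have := passP g v t2; rewrite gE size_table => e.
exists (false, v.1.2, (b, h'.1.1), set ts tape2 (rest_tape [::] (table rho' h'.1.2))).
by split; [exact: e | rewrite /represents !get_set /= oE | ].
Qed.

Lemma represents_eq L m (rho rho' : 'I_5 -> nat) (h : tstate m) c :
  rho =1 rho' -> represents L rho h c -> represents L rho' h c.
Proof. by move=> rr; case=> ? ? tE; split=> //; rewrite tE (eq_table _ rr). Qed.

(** A compiled loop starts wherever its pointer stands; it relies on the pointer being 0, which
    holds initially and is restored by the reset pass at the end of each loop. This is the purpose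
    of [nested] and of the hypothesis on [rho]. *)
Lemma compileP L m n p (rho : 'I_5 -> 'I_m.+1) (h : tstate m) c :
  nested n p -> (forall i : 'I_5, i < n -> rho i = ord0) ->
  represents L (fun i => rho i) h c ->
  exists c', exec (compile p) (cost p m.+1) c c' /\
             represents L (fun i => rho i) (sem p rho h) c'.
Proof.
elim: p n rho h c => [i j f|e|p IHp q IHq|i p IHp] n rho h c /=.
- move=> _ _ hc.
  have [|//|c' [e hc' _]] := pass_table (g := op_pass i j f) (rho' := fun k => rho k)
      (h' := do_op f (rho i, rho j) h) hc.
    exists c.1.2.1; rewrite mealy_op /do_op; have [-> _ _] := hc.
    by case: (f _ _).
    by rewrite /do_op; case: (f _ _).
  by exists c'.
- case: c => v ts _ _ [uE t0 t2]; exists (v, set ts ord0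
    (Tape (rev [seq Some (inl s) | s <- (do_emit e h).2] ++ None :: L) [::])).
  split; last by rewrite /represents !get_set.
  have := writeP (fun q => omap inl (e q.2)) v t0; rewrite uE.
  rewrite /do_emit; case: (e _) => [s|] //=.
  by rewrite map_rcons rev_rcons.
- move=> /andP[np nq] r0 hc.
  have [c1 [e1 hc1]] := IHp _ _ _ _ np r0 hc.
  have [c2 [e2 hc2]] := IHq _ _ _ _ nq r0 hc1.
  by exists c2; split=> //; apply: exec_seq e1 e2 _.
move=> /andP[i_n np] r0 hc.
pose body := Seq (compile p) (Seq (update _ _ (fun q => (false, false, false, q.2)))
                       (pass tape2 (shift_pass i))).
pose k := cost p m.+1 + (1 + pass_cost (m.+1 * m.+1)).
pose F (h : tstate m) a := sem p (repoint rho i a) h.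
(* [s] lists the vertices still to be visited, from the current pointer [a0] on. It is nonempty
   because the body runs before the test. *)
suff loop (s : seq 'I_m.+1) a0 g d : s != [::] ->
    map val s = iota a0 (size s) -> a0 + size s = m.+1 ->
    represents L (repoint (fun i => rho i : nat) i a0) g d ->
    exists d', exec (Loop body (fun v => ~~ v.2.1.2)) (size s * k) d d' /\
               represents L (repoint (fun i => rho i : nat) i m.+1) (foldl F g s) d'.
  have [||||d [e hd]] := loop (enum 'I_m.+1) 0 h c.
  - by rewrite -size_eq0 size_enum_ord.
  - exact: enum_ord_iota.
  - by rewrite size_enum_ord.
  - apply: represents_eq hc => j; rewrite /repoint; case: eqP => // ->.
    by rewrite r0.
  have [|//|c' [e' hc' _]] := pass_table (g := reset_pass i)
    (rho' := repoint (repoint (fun i => rho i : nat) i m.+1) i 0)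
    (h' := foldl F h (enum 'I_m.+1)) hd.
    exists d.1.2.1; rewrite mealy_reset; have [<- _ _] := hd.
    by case: (d) => -[[? ?] [? ?]].
  exists c'; split.
    by apply: exec_seq e e' _; rewrite size_enum_ord.
  apply: represents_eq hc' => j; rewrite /repoint; case: eqP => // ->.
  by rewrite r0.
elim: s a0 g d => // a s IHs a0 g d _ [aE sE] sz hd.
have [||d1 [e1 hd1]] := IHp i (repoint rho i a) g d np.
- by move=> j ji; rewrite /repoint ifN ?r0 ?(ltn_trans ji) // neq_ltn ji.
- by apply: represents_eq hd => j; rewrite /repoint -aE; case: eqP.
have {hd1} hd1 : represents L (repoint (fun i => rho i : nat) i a0) (F g a) d1.
  by apply: represents_eq hd1 => j; rewrite /repoint -aE; case: eqP.
case: d1 e1 hd1 => v1 ts1 e1 hd1.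
pose d2 := (v1.1, (false, false, false, v1.2.2), ts1) :
  bool * option symb * memory * tapes S table_cell.
have hd2 : represents L (repoint (fun i => rho i : nat) i a0) (F g a) d2 by [].
have e2 : exec (update _ _ (fun q => (false, false, false, q.2))) 1 (v1, ts1) d2.
  exact: updateP.
have [q qE] := mealy_shift i (repoint (fun i => rho i : nat) i a0) (F g a).1.2 (F g a).1.1.
have [|//|d3 [e3 hd3 zE]] := pass_table (g := shift_pass i)
    (rho' := repoint (fun i => rho i : nat) i a0.+1) (h' := F g a) hd2.
  exists (q, repoint (fun i => rho i : nat) i a0 i == m).
  have [/= -> _ _] := hd2; rewrite qE; congr pair; apply: eq_table => j.
  by rewrite /repoint eqxx; case: eqP.
have {zE} zE : d3.1.2.1.2 = (a0 == m).
  by rewrite zE /=; have [/= -> _ _] := hd2; rewrite qE /= /repoint eqxx.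
have e : exec body k d d3 by apply: exec_seq e1 _ (leqnn _); apply: exec_seq e2 e3 _.
case: s IHs sE sz => [|b s] IHs sE sz.
  exists d3; split; last first.
    by apply: represents_eq hd3 => j; congr repoint; rewrite -sz /= addn1.
  apply: exec_stop e _ _; last by rewrite mul1n.
  by rewrite negbK zE -eqSS -sz addn1.
have [||||d' [e' hd']] := IHs a0.+1 (F g a) d3 => //; first by move: sz; rewrite /= addnS.
exists d'; split=> //; apply: exec_next e _ e' _; last by rewrite mulSn.
by rewrite zE neq_ltn; move: sz => /=; lia.
Qed.

Definition poly_bounded (f : nat -> nat) : Prop :=
  exists p : {poly nat}, forall n, f n <= (p.[n])%R.

Lemma poly_bounded_const k : poly_bounded (fun=> k).
Proof. by exists (k%:P)%R => n; rewrite hornerC. Qed.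

Lemma poly_bounded_id : poly_bounded id.
Proof. by exists ('X)%R => n; rewrite hornerX. Qed.

Lemma poly_bounded_add f g :
  poly_bounded f -> poly_bounded g -> poly_bounded (fun n => f n + g n).
Proof. by case=> p pf [q qg]; exists (p + q)%R => n; rewrite hornerD leq_add. Qed.

Lemma poly_bounded_mul f g :
  poly_bounded f -> poly_bounded g -> poly_bounded (fun n => f n * g n).
Proof. by case=> p pf [q qg]; exists (p * q)%R => n; rewrite hornerM leq_mul. Qed.

End TablePrograms.

(** * Writing the initial table from the input, and the complete machine *)

Section TableMachine.
Variables S C U : finType.
Notation table_cell := (C * (bool * bool) * {ffun 'I_5 -> bool * bool})%type.
Notation symb := (S + table_cell)%type.
Notation memory := (bool * bool * bool * U)%type.
Notation vars := (bool * option symb * memory)%type.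

(* Column 0 of the table stands for no input symbol, column b.+1 for the b-th. *)
Variable c0 : bool -> option S -> C.
Variable u0 : U.

Definition column_symbol (s : seq S) (b : nat) : option S :=
  nth None (None :: map Some s) b.

Definition init_table (s : seq S) : {ffun 'I_(size s).+1 * 'I_(size s).+1 -> C} :=
  [ffun x : 'I_(size s).+1 * 'I_(size s).+1 =>
    c0 (x.1 == 0 :> nat) (column_symbol s x.2)].

Lemma column_symbol_None s (b : 'I_(size s).+1) :
  (column_symbol s b == None) = (b == 0 :> nat).
Proof.
case: b => -[|b] //= lt_b; rewrite /column_symbol /=.
by case: s lt_b => // x s lt_b; rewrite (nth_map x).
Qed.

Definition init_entry (fr : bool) (x : option S) : symb :=
  inr (c0 fr x, (fr, x == None), [ffun=> (fr, x == None)]).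

Definition init_row (s : seq S) (fr : bool) : seq symb :=
  map (init_entry fr) (None :: map Some s).

Lemma table_init s :
  table S (fun=> 0) (init_table s) =
  init_row s true ++ flatten (nseq (size s) (init_row s false)).
Proof.
have row (a : 'I_(size s).+1) :
    map (table_entry S (fun=> 0) (init_table s)) (map (pair a) (enum 'I_(size s).+1)) =
    init_row s (a == 0 :> nat).
  rewrite -map_comp; pose f i := init_entry (a == 0 :> nat) (column_symbol s i).
  transitivity (map f (map val (enum 'I_(size s).+1))).
    rewrite -map_comp; apply: eq_map => b /=.
    rewrite /f /init_entry /table_entry ffunE column_symbol_None; congr (inr (_, _)).
    by apply/ffunP=> k; rewrite !ffunE !(eq_sym 0).
  rewrite val_enum_ord /f /init_row (map_comp (init_entry _)).
  by rewrite -[in RHS](mkseq_nth None (None :: map Some s)) /= size_map.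
have rows n k (h : k + n <= (size s).+1) : 0 < k ->
    map (table_entry S (fun=> 0) (init_table s))
      [seq (a, b) | a <- drop k (take (k + n) (enum 'I_(size s).+1)), b <- enum 'I_(size s).+1]
    = flatten (nseq n (init_row s false)).
  elim: n k h => [|n IH] k h k0.
    by rewrite addn0 drop_oversize // size_take; case: ifP; lia.
  rewrite (drop_nth ord0); last by rewrite size_take size_enum_ord; case: ifP; lia.
  rewrite /= map_cat row nth_take; last by lia.
  rewrite nth_enum_ord; last by lia.
  by rewrite -addSnnS IH // ?addSnnS // (gtn_eqF k0).
have := rows (size s) 1 (leqnn _) isT; rewrite take_oversize ?size_enum_ord // => <-.
rewrite /table /cells -[X in flatten (map _ X)](cat_take_drop 1 (enum 'I_(size s).+1)).
rewrite allpairs_cat map_cat; congr cat.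
by rewrite (take_nth ord0) ?size_enum_ord // take0 /= map_cat row nth_enum_ord //= cats0.
Qed.

Definition tape1 : 'I_3 := @Ordinal 3 1 isT.

Definition not_first (q : memory) : bool := q.1.1.1.

(** The head of tape 0 serves as row counter: one row is written per input symbol and one more at
    the final blank, hence [(size s).+1] rows. The contents of the rows come from a second copy of
    the input on tape 1. Stepping over the blank also brings the head of tape 0 to where the output
    begins. *)
Definition row_prog : prog S table_cell vars :=
  Seq (write tape2 (fun q : memory => Some (init_entry (~~ not_first q) None)))
    (Seq (transduce tape1 tape2 (fun q x =>
            if x is inl s then init_entry (~~ not_first q) (Some s) else x))
         (Step ord0 (fun v c =>
            (isSome c, v.1.2, (true, false, false, v.2.2), c, MoveRight)))).

Definition build_prog : prog S table_cell vars :=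
  Seq (transduce ord0 tape1 (fun _ x => x))
    (Seq (Seq (back _ _ _ tape1) (rewind _ _ _ tape1))
      (Seq (Loop row_prog (@going _ _ _))
        (Seq (back _ _ _ tape2) (rewind _ _ _ tape2)))).

Definition build_cost n :=
  transduce_cost n + (n.+2 + (n.+1 * (transduce_cost n).+2 + (n.+1 * n.+1).+2)).

Lemma row_progP s l s2 L (v : vars) (ts : tapes S table_cell) :
  get ts ord0 = Tape l (map Some (map inl s2)) ->
  get ts tape1 = rest_tape [::] (map inl s) ->
  get ts tape2 = Tape L [::] ->
  exec row_prog (transduce_cost (size s)).+2 (v, ts)
   (s2 != [::], None, (true, false, false, v.2.2),
    set (set ts tape2 (Tape (rev (map Some (init_row s (~~ not_first v.2))) ++ L) [::]))
      ord0 (Tape (ohead (map inl s2) :: l) (map Some (map inl (behead s2))))).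
Proof.
move=> t0 t1 t2.
have e1 := writeP (fun q : memory => Some (init_entry (~~ not_first q) None)) v t2.
set ts1 := set ts tape2 _ in e1.
have t11 : get ts1 tape1 = rest_tape [::] (map inl s) by rewrite get_set.
have t12 : get ts1 tape2 = Tape (Some (init_entry (~~ not_first v.2) None) :: L) [::].
  by rewrite get_set.
have e2 := @transduceP _ _ _ tape1 tape2 (fun q x =>
  if x is inl s then init_entry (~~ not_first q) (Some s) else x) _ _ _ v _ isT t11 t12.
rewrite size_map in e2.
set ts2 := set ts1 tape2 _ in e2.
have -> : set ts tape2 (Tape (rev (map Some (init_row s (~~ not_first v.2))) ++ L) [::]) = ts2.
  rewrite /ts2 set_set; congr (set _ _ (Tape _ _)).
  rewrite /init_row /= rev_cons cat_rcons; congr (rev _ ++ _).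
  by rewrite -!map_comp.
apply: exec_seq e1 _ (_ : 1 + (transduce_cost (size s)).+1 <= _) => //.
apply: exec_seq e2 _ (_ : _ + 1 <= _); last by rewrite addn1.
have t20 : get ts2 ord0 = Tape l (map Some (map inl s2)) by rewrite !get_set.
apply: (@exec_step _ _ _ _ _ _ _ _ (ohead (map inl s2)) MoveRight) => //; rewrite t20.
  by case: (s2).
by case: (s2).
Qed.

Lemma rows_progP s l s2 L (v : vars) (ts : tapes S table_cell) :
  get ts ord0 = Tape l (map Some (map inl s2)) ->
  get ts tape1 = rest_tape [::] (map inl s) ->
  get ts tape2 = Tape L [::] ->
  exists v', v'.2.2 = v.2.2 /\
  exec (Loop row_prog (@going _ _ _)) ((size s2).+1 * (transduce_cost (size s)).+2) (v, ts)
   (v', set (set ts tape2 (Tape (rev (map Some (init_row s (~~ not_first v.2) ++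
                                 flatten (nseq (size s2) (init_row s false)))) ++ L) [::]))
      ord0 (Tape (None :: rev (map Some (map inl s2)) ++ l) [::])).
Proof.
elim: s2 l L v ts => [|x s2 IH] l L v ts t0 t1 t2.
  exists (false, None, (true, false, false, v.2.2)); split=> //.
  have e := row_progP v t0 t1 t2; rewrite /= cats0.
  by apply: exec_stop e _ _; rewrite ?mul1n.
have e := row_progP v t0 t1 t2.
set L1 := rev _ ++ L in e; set ts1 := set _ ord0 _ in e; set v1 := (_ != _, _, _) in e.
have [|||v' [v'E e']] := IH (Some (inl x) :: l) L1 v1 ts1; rewrite ?get_set //.
exists v'; split; first by rewrite v'E.
apply: exec_next e _ _ _; last first.
- by rewrite mulSn.
- have -> : forall (t t' : tape symb), set (set ts tape2 t) ord0 t' = set (set ts1 tape2 t) ord0 t'.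
    by move=> t t'; rewrite /ts1.
  rewrite (_ : rev (map Some (map inl (x :: s2))) ++ l =
    rev (map Some (map inl s2)) ++ Some (inl x) :: l); last by rewrite /= rev_cons cat_rcons.
  move: e'; rewrite /L1 catA -rev_cat -map_cat => e'.
  exact: e'.
- by [].
Qed.

Lemma build_progP s (v : vars) :
  let L := rev (map Some (map inl s)) ++ [:: None] in
  exists c, exec build_prog (build_cost (size s))
     (v, (rest_tape [::] (map inl s), Tape [:: None] [::], Tape [:: None] [::])) c /\
    (v.2.2 = u0 -> not_first v.2 = false -> represents L (fun=> 0) (u0, init_table s, [::]) c).
Proof.
move=> L; set ts := (_, _, _).
have t0 : get ts ord0 = rest_tape [::] (map inl s) by [].
have t1 : get ts tape1 = Tape [:: None] [::] by [].
have e1 := @transduceP _ _ _ ord0 tape1 (fun _ x => x) _ _ _ v ts isT t0 t1.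
rewrite size_map in e1; set ts1 := set _ _ _ in e1; set v1 := (false, _, _) in e1.
have t11 : get ts1 tape1 = Tape (rev (map Some (map inl s)) ++ [:: None]) [::].
  by rewrite get_set eqxx.
have e2 := back_rewindP v1 t11.
rewrite size_map in e2; set ts2 := set _ _ _ in e2; set v2 := (false, _, _) in e2.
have [|||v3 [v3E e3]] := @rows_progP s [:: None] s [:: None] v2 ts2; rewrite ?get_set //.
set ts3 := set _ _ _ in e3.
have t32 : get ts3 tape2 = Tape (rev (map Some (init_row s (~~ not_first v.2) ++
    flatten (nseq (size s) (init_row s false)))) ++ [:: None]) [::].
  by rewrite !get_set.
have e4 := back_rewindP v3 t32.
have sz : size (init_row s (~~ not_first v.2) ++ flatten (nseq (size s) (init_row s false)))
    = (size s).+1 * (size s).+1.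
  rewrite size_cat size_flatten /shape map_nseq sumn_nseq /init_row !size_map /= !size_map.
  by rewrite -mulnS.
rewrite sz in e4; eexists; split.
  by apply: exec_seq e1 (exec_seq e2 (exec_seq e3 e4 (leqnn _)) (leqnn _)) (leqnn _).
move=> vu nf; split; rewrite ?get_set //=.
- by rewrite v3E.
- by rewrite table_init nf.
Qed.

Definition table_machine (p : table_prog S C U) : turing_machine S :=
  machine (false, None, (false, false, false, u0))
    (Seq build_prog (Seq (compile p) (Seq (back _ _ _ ord0) (rewind _ _ _ ord0)))).

(** Emitting a symbol takes a step, so [cost] bounds the length of the output too, and with it the
    time of the final rewind. *)
Lemma sem_size m (p : table_prog S C U) rho (h : tstate S C U m) :
  size (sem p rho h).2 <= size h.2 + cost p m.+1.
Proof.
elim: p rho h => [i j f|e|p IHp q IHq|i p IHp] rho h /=.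
- by rewrite /do_op; case: (f _ _) => *; rewrite leq_addr.
- by rewrite /do_emit; case: (e _) => [s|] /=; rewrite ?size_rcons ?addn1 ?leq_addr.
- by rewrite addnA; apply: leq_trans (IHq _ _) _; rewrite leq_add2r IHp.
rewrite -[X in _ <= _ + (X * _ + _)](size_enum_ord m.+1).
elim: (enum _) h => [|a s IH] h /=; first by rewrite leq_addr.
apply: leq_trans (IH _) _; have := IHp (repoint rho i a) h.
by rewrite (mulSn (size s)); lia.
Qed.

Lemma poly_bounded_comp_succ f : poly_bounded f -> poly_bounded (fun n => f n.+1).
Proof.
case=> p pf; exists (p \Po ('X + 1))%R => n; rewrite horner_comp !hornerE.
by rewrite -[(_ + _)%R]/(n + 1) addn1.
Qed.

Lemma poly_bounded_leq f g : (forall n, f n <= g n) -> poly_bounded g -> poly_bounded f.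
Proof. by move=> fg [p pg]; exists p => n; apply: leq_trans (fg n) (pg n). Qed.

Lemma poly_bounded_pass : poly_bounded (fun m => pass_cost (m * m)).
Proof.
apply: (@poly_bounded_leq _ (fun m => 2 * (m * m) + 2)); first by move=> n; rewrite /pass_cost; lia.
by do !(apply: poly_bounded_add || apply: poly_bounded_mul || exact: poly_bounded_const
        || exact: poly_bounded_id).
Qed.

Lemma poly_bounded_cost (p : table_prog S C U) : poly_bounded (cost p).
Proof.
elim: p => [i j f|e|p IHp q IHq|i p IHp] /=.
- exact: poly_bounded_pass.
- exact: poly_bounded_const.
- exact: poly_bounded_add.
apply: poly_bounded_add poly_bounded_pass.
apply: poly_bounded_mul poly_bounded_id _; apply: poly_bounded_add => //.
exact: poly_bounded_add (poly_bounded_const 1) poly_bounded_pass.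
Qed.

Lemma table_machineP (p : table_prog S C U) :
  nested 5 p ->
  exists P : {poly nat}, forall s : seq S,
    exists2 t, t <= (P.[size s])%R &
      halts_with_output (table_machine p) s
        (sem p (fun=> ord0) (u0, init_table s, [::])).2 t.
Proof.
move=> np.
pose K n := build_cost n + (cost p n.+1 + (cost p n.+1).+2).
have [P PK] : poly_bounded K.
  have [Q Qc] := poly_bounded_comp_succ (poly_bounded_cost p).
  pose g n := (3 * n + 3) + (n + 2 + ((n + 1) * (3 * n + 5) + ((n + 1) * (n + 1) + 2)))
              + (Q.[n]%R + (Q.[n]%R + 2)).
  apply: (@poly_bounded_leq _ g).
    by move=> n; rewrite /K /g /build_cost /transduce_cost; have := Qc n; lia.
  have Qb : poly_bounded (fun n => Q.[n]%R) by exists Q.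
  by do !(apply: poly_bounded_add || apply: poly_bounded_mul || exact: poly_bounded_const
          || exact: poly_bounded_id || exact: Qb).
exists P => s; set h := sem _ _ _.
have [c1 [e1 hc1]] := build_progP s (false, None, (false, false, false, u0)).
have [c2 [e2 hc2]] := compileP (rho := fun=> ord0) np (fun _ _ => erefl) (hc1 erefl erefl).
case: c2 e2 hc2 => v2 ts2 e2 [_ t20 _].
have t20' : get ts2 ord0 = Tape (rev (map Some (map inl h.2)) ++
   None :: rev (map Some (map inl s)) ++ [:: None]) [::].
  by rewrite -map_comp.
have e3 := back_rewindP v2 t20'; rewrite size_map in e3.
have le : (size h.2).+2 <= (cost p (size s).+1).+2.
  by have := sem_size p (fun=> ord0) (u0, init_table s, [::]); rewrite /= add0n.
have {e3} e3 := exec_leq e3 le.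
have e : exec _ (K (size s)) _ _ := exec_seq e1 (exec_seq e2 e3 (leqnn _)) (leqnn _).
rewrite /rest_tape -(map_comp Some inl s) in e.
set ts3 := set ts2 _ _ in e.
have g0 : get ts3 ord0 = rest_tape (rev (map Some (map inl s)) ++ [:: None]) (map inl h.2).
  by rewrite get_set /rest_tape -(map_comp Some inl s).
have [t tK tH] := machine_halts e g0 (up_to_blank_Some (map inl h.2)).
by exists t => //; apply: leq_trans tK (PK _).
Qed.

End TableMachine.

(** * Saturated graphs over a free group *)

Section ShortWords.
Variable A : choiceType.
Implicit Types (l m : letter A) (w : word A) (g : freeGroup A).

(* Reduced words of length at most one. *)
Notation short := (option (letter A)).
Implicit Types x y z : short.

Definition short_elt x : freeGroup A :=
  if x is Some l then eval_letter (@basis_elt A) l else 1%g.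

Definition short_inv x : short := omap (@inv_letter A) x.

(** The result [None] means that the product has length two; [Some None] is the empty word. *)
Definition short_mul x y : option short :=
  match x, y with
  | None, _ => Some y
  | _, None => Some x
  | Some l, Some m => if m == inv_letter l then Some None else None
  end.

Lemma reduced_word_letter l : reduced_word (eval_letter (@basis_elt A) l) = [:: l].
Proof. by case: l => a []. Qed.

Lemma eval_letter_inv l :
  eval_letter (@basis_elt A) (inv_letter l) = (eval_letter (@basis_elt A) l)^-1%g.
Proof. by case: l => a [] //=; rewrite /eval_letter /= invgK. Qed.

Lemma short_elt_inv x : short_elt (short_inv x) = (short_elt x)^-1%g.
Proof. by case: x => [l|] /=; rewrite ?eval_letter_inv ?invg1. Qed.

Lemma short_elt_mul x y z :
  short_mul x y = Some z -> short_elt z = (short_elt x * short_elt y)%g.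
Proof.
case: x y => [l|] [m|] //=; last by case=> <-; rewrite mulg1.
- by case: eqP => // -> [<-]; rewrite /= eval_letter_inv mulgV.
- by case=> <-; rewrite mulg1.
- by case=> <-; rewrite mul1g.
Qed.

Lemma reduced_word_short_mul x g :
  reduced_word (short_elt x * g)%g =
  if x is Some l then push l (reduced_word g) else reduced_word g.
Proof.
case: x => [l|]; last by rewrite [short_elt _]/= mul1g.
by rewrite [LHS]val_fg_mul [val (short_elt _)]reduced_word_letter.
Qed.

Lemma element_of_cons l w : element_of (l :: w) = (short_elt (Some l) * element_of w)%g.
Proof. by rewrite /element_of /eval_word big_cons. Qed.

Lemma element_of_nil : element_of [::] = 1%g :> freeGroup A.
Proof. by rewrite /element_of /eval_word big_nil. Qed.

Lemma element_of_rcons w l : element_of (rcons w l) = (element_of w * short_elt (Some l))%g.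
Proof. by rewrite /element_of /eval_word -cats1 big_cat /= big_seq1. Qed.

Lemma element_of_eq1 w : reduced w -> (element_of w == 1%g) = (w == [::]).
Proof.
move=> rw; apply/eqP/eqP => [w1|->]; last exact: element_of_nil.
by have := congr1 (@reduced_word A) w1; rewrite val_element_of reduce_id.
Qed.

Lemma size_reduce w : size (reduce w) <= size w.
Proof.
elim: w => //= l w IH; apply: leq_trans (_ : (size (reduce w)).+1 <= _) => //.
by case: (reduce w) => //= m w'; case: ifP => // _; apply: leqW.
Qed.

Lemma generated_trivial (s : seq (freeGroup A)) g :
  generated s g -> {in s, forall f, f = 1%g} -> g = 1%g.
Proof.
elim=> [f fs|//|f f' _ IH _ IH'|f _ IH] s1; first exact: s1.
- by rewrite IH // IH' // mulg1.
by rewrite IH // invg1.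
Qed.

End ShortWords.

(** * Paths and spelled words in a saturated graph *)

Section Saturation.
Variables (A : finType) (V : finType).
Notation short := (option (letter A)).
Implicit Types (l m : letter A) (w : word A) (g : freeGroup A) (x y z : short) (p q r : V).
Implicit Types E : V -> V -> {set short}.

Inductive path_label E : V -> V -> freeGroup A -> Prop :=
| path_label_nil p : path_label E p p 1%g
| path_label_cons p q r x g :
    x \in E p q -> path_label E q r g -> path_label E p r (short_elt x * g)%g.

Lemma path_label_edge E p q x : x \in E p q -> path_label E p q (short_elt x).
Proof.
by move=> xE; rewrite -[short_elt x]mulg1; apply: path_label_cons xE _; constructor.
Qed.

Lemma path_label_cat E p q r g1 g2 :
  path_label E p q g1 -> path_label E q r g2 -> path_label E p r (g1 * g2)%g.
Proof.
move=> pg; elim: pg r g2 => {p q g1} [p|p q q' x g xE _ IH] r g2 qg; first by rewrite mul1g.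
by rewrite -mulgA; apply: path_label_cons xE _; apply: IH.
Qed.

Lemma path_label_inv E p q g :
  (forall p q x, x \in E p q -> short_inv x \in E q p) ->
  path_label E p q g -> path_label E q p g^-1%g.
Proof.
move=> symE; elim=> {p q g} [p|p q r x g xE _ IH]; first by rewrite invg1; constructor.
rewrite invgM -short_elt_inv; apply: path_label_cat IH _.
exact/path_label_edge/symE.
Qed.

Definition saturated E : Prop :=
  (forall p, None \in E p p) /\
  (forall p q r x y z, x \in E p q -> y \in E q r -> short_mul x y = Some z -> z \in E p r).

Fixpoint spells E p w q : Prop :=
  if w is l :: w' then exists2 r, Some l \in E p r & spells E r w' q
  else None \in E p q.

(** [push] either prepends the letter or cancels it against the first letter of [w]. In the second
    case saturation yields an empty label over the two edges, and an empty label is absorbed by the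
    letter that follows, or by the final empty label. Applied edge by edge from the end of a path,
    this reduces its label within the graph. *)
Lemma spells_push E p q r x w :
  saturated E -> x \in E p q -> spells E q w r ->
  spells E p (if x is Some l then push l w else w) r.
Proof.
case=> refl sat; have absorb p' q' w' : None \in E p' q' -> spells E q' w' r -> spells E p' w' r.
  case: w' => [|m w'] /= eps; first by move=> eps'; apply: sat eps eps' _.
  by case=> r' mE wE; exists r' => //; apply: sat eps mE _.
case: x => [l|] xE; last exact: absorb.
case: w => [|m w] /=; first by move=> eps; exists r => //; apply: sat xE eps _.
case=> r' mE wE; case: eqP => [ml|_]; last by exists q => //; exists r'.
by apply: absorb wE; apply: sat xE mE _; rewrite /= ml eqxx.
Qed.

Lemma path_label_spells E0 E p q g :
  (forall p q, E0 p q \subset E p q) -> saturated E ->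
  path_label E0 p q g -> spells E p (reduced_word g) q.
Proof.
move=> sub sat; elim=> {p q g} [p|p q r x g xE _ IH]; first exact: sat.1.
rewrite reduced_word_short_mul; apply: spells_push IH => //.
exact: subsetP xE.
Qed.

Lemma spells_path_label E0 E p q w :
  (forall p q x, x \in E p q -> path_label E0 p q (short_elt x)) ->
  spells E p w q -> path_label E0 p q (element_of w).
Proof.
move=> sound; elim: w p => [|l w IH] p /=.
  by rewrite element_of_nil; exact: sound.
case=> r lE wE; rewrite element_of_cons; apply: path_label_cat _ (IH _ wE).
exact: sound.
Qed.

Fixpoint leads_to (b : V) E p w : Prop :=
  if w is l :: w' then exists2 r, Some l \in E p r & leads_to b E r w' else p = b.

(** The final empty label merges into the last letter by saturation, so the search has no empty
    labels to follow; the empty word has no such letter. *)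
Lemma spells_leads_to b E p w :
  saturated E -> w != [::] -> spells E p w b -> leads_to b E p w.
Proof.
case=> refl sat; elim: w p => //= l [|m w] IH p _ [r lE wE].
  by exists b => //; apply: sat lE wE _.
by exists r => //; apply: IH.
Qed.

Lemma leads_to_spells b E p w : None \in E b b -> leads_to b E p w -> spells E p w b.
Proof.
move=> eps; elim: w p => [|l w IH] p /=; first by move->.
by case=> r lE wE; exists r => //; apply: IH.
Qed.

End Saturation.

(** * The bouquet of the generators and the subgroup it carries *)

Section Bouquet.
Variable A : finType.
Notation short := (option (letter A)).
Implicit Types (l m : letter A) (w h : word A) (g : freeGroup A) (x : short).

(* A marked word: [None] ends a generator. *)
Definition marked (hs : seq (word A)) : seq short :=
  flatten [seq rcons (map Some h) None | h <- hs].

Section Graph.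
Variables (m : nat) (mark : 'I_m.+1 -> short).
Implicit Types p q r : 'I_m.+1.

(* The vertices are the positions in the marked word, the initial one included;
   the empty label joins all the positions where a generator begins or ends. *)
Definition bouquet p q : {set short} :=
  [set x | [|| (p == q) && (x == None),
               [&& mark p == None, mark q == None & x == None],
               (q == p.+1 :> nat) && (x == mark q)
             | (p == q.+1 :> nat) && (x == short_inv (mark p))]].

Lemma short_invK : involutive (@short_inv A).
Proof. by case=> [l|] //=; rewrite inv_letterK. Qed.

Lemma bouquet_sym p q x : x \in bouquet p q -> short_inv x \in bouquet q p.
Proof.
rewrite !inE; case/or4P=> [/andP[/eqP-> /eqP->]|/and3P[-> -> /eqP->]|/andP[-> /eqP->]|
  /andP[-> /eqP->]]; rewrite ?eqxx ?short_invK ?eqxx ?orbT //.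
Qed.

End Graph.

(** The letters since the last end marker, that is, the part already read of the current
    generator. *)
Definition suffix_word (t : seq short) : word A :=
  foldl (fun w x => if x is Some l then rcons w l else [::]) [::] t.

Lemma suffix_word_rcons t x :
  suffix_word (rcons t x) = if x is Some l then rcons (suffix_word t) l else [::].
Proof. by rewrite /suffix_word -cats1 foldl_cat. Qed.

Lemma suffix_word_map h : suffix_word (map Some h) = h.
Proof.
elim/last_ind: h => // h l IH.
by rewrite map_rcons suffix_word_rcons IH.
Qed.

Lemma suffix_word_cat t1 t2 : suffix_word (t1 ++ None :: t2) = suffix_word t2.
Proof. by rewrite /suffix_word foldl_cat. Qed.

Lemma suffix_word_marked hs k :
  let s := marked hs in
  k < size s -> nth None s k = None -> suffix_word (take k s) \in hs.
Proof.
rewrite /marked; elim: hs k => [|h hs IH] //= k.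
rewrite cat_rcons size_cat nth_cat take_cat /= size_map.
case: (ltnP k (size h)) => [kh _|hk].
  by case: h kh => // l h' kh; rewrite (nth_map l).
case kE: (k - size h) => [|k'] /= lt_k nk.
  by rewrite cats0 suffix_word_map mem_head.
rewrite suffix_word_cat inE IH ?orbT //.
by rewrite -(subnKC hk) kE in lt_k; move: lt_k; rewrite ltn_add2l.
Qed.

Variables (hs : seq (word A)) (m : nat).
Notation s := (marked hs).
Variable vertex_mark : 'I_m.+1 -> short.
Hypothesis size_s : size s = m.
Hypothesis vertex_markE : forall p : 'I_m.+1, vertex_mark p = nth None (None :: s) p.
Implicit Types p q r : 'I_m.+1.

Notation graph := (bouquet vertex_mark).

(* The label of a path from the base vertex to [p]. *)
Definition potential p : freeGroup A := element_of (suffix_word (take p s)).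

Lemma potential_mark p : vertex_mark p = None -> potential p = 1%g.
Proof.
rewrite vertex_markE /potential; case: p => -[|p] /= lt_p; first by rewrite take0 element_of_nil.
by move=> mp; rewrite (take_nth None) ?size_s // suffix_word_rcons mp element_of_nil.
Qed.

Notation H := (generated [seq element_of h | h <- hs]).

(** Potentials are labels along a spanning tree. Corrected by the potentials of its ends, a label
    becomes trivial, except on an edge into an end marker, where it is a generator, or its inverse
    when the edge is traversed backwards. *)
Lemma bouquet_sound p q x :
  x \in graph p q -> H (potential p * short_elt x * (potential q)^-1)%g.
Proof.
have next p' q' : q' = p'.+1 :> nat ->
    H (potential p' * short_elt (vertex_mark q') * (potential q')^-1)%g.
  move=> qp; have lt_p : p' < m by rewrite -ltnS -qp ltn_ord.
  have mq : vertex_mark q' = nth None s p' by rewrite vertex_markE qp.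
  have := potential_mark (p := q'); rewrite mq /potential qp (take_nth None) ?size_s //.
  rewrite suffix_word_rcons; case mE: (nth None s p') => [l|] => [_|->] //.
    by rewrite element_of_rcons mulgV; apply: generated_one.
  rewrite invg1 !mulg1; apply/generated_mem/map_f.
  by apply: suffix_word_marked; rewrite ?size_s.
rewrite inE; case/or4P=> [/andP[/eqP-> /eqP->]|/and3P[/eqP p1 /eqP q1 /eqP->]|
  /andP[/eqP qp /eqP->]|/andP[/eqP pq /eqP->]].
- by rewrite mulg1 mulgV; apply: generated_one.
- by rewrite !potential_mark // invg1 !mulg1; apply: generated_one.
- exact: next.
have := generated_inv (next q p pq).
by rewrite !invgM invgK -short_elt_inv mulgA.
Qed.

Lemma path_label_sound p q g :
  path_label graph p q g -> H (potential p * g * (potential q)^-1)%g.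
Proof.
elim=> {p q g} [p|p q r x g xE _ IH]; first by rewrite mulg1 mulgV; apply: generated_one.
have := generated_mul (bouquet_sound xE) IH.
by rewrite !mulgA mulgVK.
Qed.

Lemma path_label_word k h :
  k + size h <= m -> take (size h) (drop k s) = map Some h ->
  path_label graph (inord k) (inord (k + size h)) (element_of h).
Proof.
elim: h k => [|l h IH] k /=; first by rewrite addn0 element_of_nil => *; constructor.
move=> le_s; rewrite (drop_nth None) ?size_s ?(leq_trans _ le_s) ?addnS ?ltnS ?leq_addr //=.
move=> -[kl tE].
rewrite element_of_cons -addSn; apply: path_label_cat _ (IH _ _ tE); last by rewrite addSnnS.
apply: path_label_edge; rewrite inE !vertex_markE !inordK ?ltnS ?(leq_trans _ le_s) //; try lia.
by rewrite /= kl !eqxx !orbT.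
Qed.

Lemma path_label_generator h : h \in hs -> path_label graph ord0 ord0 (element_of h).
Proof.
(* [s1] is what precedes an occurrence of [h]. It is empty or ends with a marker, so the vertex
   where [h] begins is joined to the base vertex by the empty label. *)
move=> hin; have [s1 [s2 [sE s1E]]] : exists s1 s2,
    s = s1 ++ map Some h ++ None :: s2 /\ last None s1 = None.
  rewrite /marked; case/splitPr: hin => h1 h2.
  exists (flatten [seq rcons (map Some h) None | h <- h1]),
         (flatten [seq rcons (map Some h) None | h <- h2]).
  rewrite map_cat flatten_cat /= cat_rcons; split=> //.
  by elim: h1 => //= h1 hs1 IH; rewrite last_cat last_rcons.
have sz : m = size s1 + (size h + (size s2).+1) by rewrite -size_s sE !size_cat size_map.
have m1 : vertex_mark (inord (size s1)) = None.
  rewrite vertex_markE inordK ?sz; last by lia.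
  by rewrite sE -cat_cons nth_cat /= ltnS leqnn -[RHS]s1E (last_nth None).
have m2 : vertex_mark (inord (size s1 + size h).+1) = None.
  rewrite vertex_markE inordK ?sz; last by lia.
  by rewrite /= sE catA nth_cat size_cat size_map ltnn subnn.
have m0 : vertex_mark ord0 = None by rewrite vertex_markE.
have eps p q : vertex_mark p = None -> vertex_mark q = None ->
    path_label graph p q 1%g.
  by move=> mp mq; apply: (@path_label_edge _ _ _ _ _ None); rewrite inE mp mq !eqxx orbT.
have step : path_label graph (inord (size s1 + size h)) (inord (size s1 + size h).+1) 1%g.
  apply: (@path_label_edge _ _ _ _ _ None); rewrite inE m2 !inordK ?sz; try lia.
  by rewrite !eqxx !orbT.
rewrite -[element_of h]mul1g -[element_of h]mulg1.
apply: path_label_cat (eps _ _ m0 m1) _.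
apply: path_label_cat (path_label_word _ _) _; first by rewrite sz; lia.
  by rewrite sE drop_size_cat // take_size_cat // size_map.
rewrite -[1%g]mulg1; apply: path_label_cat step (eps _ _ m2 m0).
Qed.

Lemma path_label_generated g : path_label graph ord0 ord0 g <-> H g.
Proof.
split=> [/path_label_sound|].
  by rewrite potential_mark // mul1g invg1 mulg1.
elim=> {g} [g /mapP[h hin ->]||g1 g2 _ ptr1 _ ptr2|g _ Pg].
- exact: path_label_generator.
- by constructor.
- exact: path_label_cat ptr1 ptr2.
- exact: path_label_inv (@bouquet_sym _ _) Pg.
Qed.

End Bouquet.

(** * The search program *)

Section Folds.
Variables (I : eqType) (S T : Type).
Implicit Types (s : seq I).

Lemma foldl_inv (P : S -> Prop) (f : S -> I -> S) s h :
  (forall h i, P h -> P (f h i)) -> P h -> P (foldl f h s).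
Proof. by move=> Pf; elim: s h => //= i s IH h Ph; apply/IH/Pf. Qed.

Lemma foldl_rel (R : S -> T -> Prop) (f : S -> I -> S) (g : T -> I -> T) s h e :
  (forall h e i, R h e -> R (f h i) (g e i)) -> R h e -> R (foldl f h s) (foldl g e s).
Proof. by move=> Rf; elim: s h e => //= i s IH h e Rh; apply/IH/Rf. Qed.

(** For loops that must catch what happens at [x] although earlier iterations modify the state: [P]
    is what these preserve unless they achieve the goal [Q] themselves. *)
Lemma foldl_hit (P Q : S -> Prop) (f : S -> I -> S) s h x :
  (forall h i, P h -> P (f h i) \/ Q (f h i)) -> (forall h i, Q h -> Q (f h i)) ->
  (forall h, P h -> Q (f h x)) -> P h -> x \in s -> Q (foldl f h s).
Proof.
move=> Pf Qf Px; elim: s h => //= i s IH h Ph.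
rewrite inE; case: eqP => [<- _|_ /= xs]; first by apply: (foldl_inv (P := Q)) => //; apply: Px.
by case: (Pf h i Ph) => [Ph'|Qh]; [apply: IH | apply: (foldl_inv (P := Q))].
Qed.

Lemma foldl_const (f : S -> S) s h : foldl (fun h _ => f h) h s = iter (size s) f h.
Proof. by elim: s h => //= i s IH h; rewrite IH -iterSr. Qed.

End Folds.
Arguments foldl_inv {I S P f s h}.
Arguments foldl_rel {I S T R f g s h e}.
Arguments foldl_hit {I S} P Q {f s h x}.

Lemma foldl_enum_ind m (S : Type) (P : nat -> S -> Prop) (f : S -> 'I_m -> S) h :
  P 0 h -> (forall (i : 'I_m) h, P i h -> P i.+1 (f h i)) ->
  P m (foldl f h (enum 'I_m)).
Proof.
move=> ptr0 Pf.
suff H (s : seq 'I_m) k : map val s = iota k (size s) -> forall h, P k h ->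
    P (k + size s) (foldl f h s).
  by rewrite -[X in P X _](size_enum_ord m); apply: (H _ 0);
    rewrite ?val_enum_ord ?size_enum_ord.
elim: s k {h ptr0} => [|i s IH] k /=; first by rewrite addn0.
by case=> ik sE h Ph; rewrite addnS -addSn; apply: IH => //; rewrite -ik; apply: Pf; rewrite ik.
Qed.

Section Algorithm.
Variable A : finType.
Notation short := (option (letter A)).
Notation labels := {set short}.
Notation next_table := {ffun letter A -> option short}.
Implicit Types (l : letter A) (x y z : short) (w : word A).

(* [cmark], [cedge] and [cnext] belong to a pair of vertices; [cseen], [cfresh]
   and [chere] are used on the diagonal only. *)
Record tcell : Type := TCell {
  cmark : short; cedge : labels; cseen : labels; cfresh : labels;
  cnext : next_table; chere : bool }.

Definition tcell_code (c : tcell) :=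
  (cmark c, cedge c, cseen c, cfresh c, cnext c, chere c).
Definition tcell_decode d : tcell :=
  let: (a, b, c, d, e, f) := d in TCell a b c d e f.
Lemma tcell_codeK : cancel tcell_code tcell_decode.
Proof. by case. Qed.
HB.instance Definition _ := Finite.copy tcell (can_type tcell_codeK).

Record regs : Type := Regs {
  set_a : labels; set_b : labels; reg_a : short; reg_b : short; found : short;
  bit_a : bool; bit_b : bool }.

Definition regs_code (u : regs) :=
  (set_a u, set_b u, reg_a u, reg_b u, found u, bit_a u, bit_b u).
Definition regs_decode d : regs :=
  let: (a, b, c, d, e, f, g) := d in Regs a b c d e f g.
Lemma regs_codeK : cancel regs_code regs_decode.
Proof. by case. Qed.
HB.instance Definition _ := Finite.copy regs (can_type regs_codeK).

Definition put_edge (c : tcell) e :=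
  TCell (cmark c) e (cseen c) (cfresh c) (cnext c) (chere c).
Definition put_seen (c : tcell) e :=
  TCell (cmark c) (cedge c) e (cfresh c) (cnext c) (chere c).
Definition put_fresh (c : tcell) e :=
  TCell (cmark c) (cedge c) (cseen c) e (cnext c) (chere c).
Definition put_next (c : tcell) e :=
  TCell (cmark c) (cedge c) (cseen c) (cfresh c) e (chere c).
Definition put_here (c : tcell) e :=
  TCell (cmark c) (cedge c) (cseen c) (cfresh c) (cnext c) e.

Notation S := (symbol A).
Notation tprog := (table_prog S tcell regs).
Notation state := (tstate S tcell regs).

Section Tables.
Variables (m : nat) (mk : 'I_m.+1 -> short).
Notation vertex := 'I_m.+1.
Implicit Types (p q r : vertex) (E : vertex -> vertex -> labels) (O N : vertex -> labels).
Implicit Types (X : vertex -> vertex -> next_table) (H : vertex -> bool) (u : regs).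
Implicit Types (o : seq S) (rho : 'I_5 -> vertex).

(** The programs write [cseen], [cfresh] and [chere] on the diagonal only, so every table met has
    this form and the state can be handled as five functions of vertices. *)
Definition tab E O N X H : {ffun vertex * vertex -> tcell} :=
  [ffun x : vertex * vertex => TCell (mk x.2) (E x.1 x.2)
     (if x.1 == x.2 then O x.1 else set0) (if x.1 == x.2 then N x.1 else set0)
     (X x.1 x.2) ((x.1 == x.2) && H x.1)].

Definition upd1 (T : Type) (f : vertex -> T) p (v : T) : vertex -> T :=
  fun a => if a == p then v else f a.

Definition upd2 (T : Type) (f : vertex -> vertex -> T) p q (v : T) : vertex -> vertex -> T :=
  fun a b => if (a == p) && (b == q) then v else f a b.

Lemma eq_tab E E' O O' N N' X X' H H' :
  E =2 E' -> O =1 O' -> N =1 N' -> X =2 X' -> H =1 H' ->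
  tab E O N X H = tab E' O' N' X' H'.
Proof. by move=> eE eO eN eX eH; apply/ffunP=> x; rewrite !ffunE eE eO eN eX eH. Qed.

Lemma cmark_tab E O N X H (t : vertex * vertex) : cmark (tab E O N X H t) = mk t.2.
Proof. by rewrite ffunE. Qed.
Lemma cedge_tab E O N X H (t : vertex * vertex) : cedge (tab E O N X H t) = E t.1 t.2.
Proof. by rewrite ffunE. Qed.
Lemma cseen_tab E O N X H p : cseen (tab E O N X H (p, p)) = O p.
Proof. by rewrite ffunE /= eqxx. Qed.
Lemma cfresh_tab E O N X H p : cfresh (tab E O N X H (p, p)) = N p.
Proof. by rewrite ffunE /= eqxx. Qed.
Lemma cnext_tab E O N X H (t : vertex * vertex) : cnext (tab E O N X H t) = X t.1 t.2.
Proof. by rewrite ffunE. Qed.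
Lemma chere_tab E O N X H p : chere (tab E O N X H (p, p)) = H p.
Proof. by rewrite ffunE /= eqxx. Qed.
Definition tabE := (cmark_tab, cedge_tab, cseen_tab, cfresh_tab, cnext_tab, chere_tab).

Definition Read (i j : 'I_5) (g : regs -> tcell -> regs) : tprog :=
  Op S i j (fun u c => (g u c, c)).
Definition WriteEdge (i j : 'I_5) (g : regs -> tcell -> regs)
    (e : regs -> tcell -> labels) : tprog :=
  Op S i j (fun u c => (g u c, put_edge c (e u c))).
Definition WriteNext (i j : 'I_5) (g : regs -> tcell -> regs)
    (e : regs -> tcell -> next_table) : tprog :=
  Op S i j (fun u c => (g u c, put_next c (e u c))).
Definition WriteSeen (i : 'I_5) (g : regs -> tcell -> regs)
    (e : regs -> tcell -> labels) : tprog :=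
  Op S i i (fun u c => (g u c, put_seen c (e u c))).
Definition WriteFresh (i : 'I_5) (g : regs -> tcell -> regs)
    (e : regs -> tcell -> labels) : tprog :=
  Op S i i (fun u c => (g u c, put_fresh c (e u c))).
Definition WriteHere (i : 'I_5) (g : regs -> tcell -> regs) (e : regs -> tcell -> bool) : tprog :=
  Op S i i (fun u c => (g u c, put_here c (e u c))).

Lemma sem_Read i j g rho u E O N X H o :
  sem (Read i j g) rho (u, tab E O N X H, o) =
  (g u (tab E O N X H (rho i, rho j)), tab E O N X H, o).
Proof.
congr (_, _, _); apply/ffunP=> y.
by rewrite [LHS]ffunE; case: eqP => // ->.
Qed.

Lemma sem_WriteEdge i j g e rho u E O N X H o :
  let c := tab E O N X H (rho i, rho j) in
  sem (WriteEdge i j g e) rho (u, tab E O N X H, o) =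
  (g u c, tab (upd2 E (rho i) (rho j) (e u c)) O N X H, o).
Proof.
move=> c; congr (_, _, _); apply/ffunP=> -[a b].
rewrite [LHS]ffunE [RHS]ffunE xpair_eqE /upd2 /=.
by case: andP => [[/eqP-> /eqP->]|_]; rewrite /c !ffunE.
Qed.

Lemma sem_WriteNext i j g e rho u E O N X H o :
  let c := tab E O N X H (rho i, rho j) in
  sem (WriteNext i j g e) rho (u, tab E O N X H, o) =
  (g u c, tab E O N (upd2 X (rho i) (rho j) (e u c)) H, o).
Proof.
move=> c; congr (_, _, _); apply/ffunP=> -[a b].
rewrite [LHS]ffunE [RHS]ffunE xpair_eqE /upd2 /=.
by case: andP => [[/eqP-> /eqP->]|_]; rewrite /c !ffunE.
Qed.

Lemma sem_WriteSeen i g e rho u E O N X H o :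
  let c := tab E O N X H (rho i, rho i) in
  sem (WriteSeen i g e) rho (u, tab E O N X H, o) =
  (g u c, tab E (upd1 O (rho i) (e u c)) N X H, o).
Proof.
move=> c; congr (_, _, _); apply/ffunP=> -[a b].
rewrite [LHS]ffunE [RHS]ffunE xpair_eqE /upd1 /=.
have [->|ai] := eqVneq a (rho i); last by rewrite /= ffunE.
by rewrite eq_sym; case: eqP => [<-|nb]; rewrite /c !ffunE ?eqxx //=; case: eqP nb.
Qed.

Lemma sem_WriteFresh i g e rho u E O N X H o :
  let c := tab E O N X H (rho i, rho i) in
  sem (WriteFresh i g e) rho (u, tab E O N X H, o) =
  (g u c, tab E O (upd1 N (rho i) (e u c)) X H, o).
Proof.
move=> c; congr (_, _, _); apply/ffunP=> -[a b].
rewrite [LHS]ffunE [RHS]ffunE xpair_eqE /upd1 /=.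
have [->|ai] := eqVneq a (rho i); last by rewrite /= ffunE.
by rewrite eq_sym; case: eqP => [<-|nb]; rewrite /c !ffunE ?eqxx //=; case: eqP nb.
Qed.

Lemma sem_WriteHere i g e rho u E O N X H o :
  let c := tab E O N X H (rho i, rho i) in
  sem (WriteHere i g e) rho (u, tab E O N X H, o) =
  (g u c, tab E O N X (upd1 H (rho i) (e u c)), o).
Proof.
move=> c; congr (_, _, _); apply/ffunP=> -[a b].
rewrite [LHS]ffunE [RHS]ffunE xpair_eqE /upd1 /=.
have [->|ai] := eqVneq a (rho i); last by rewrite /= ffunE.
by rewrite eq_sym; case: eqP => [<-|nb]; rewrite /c !ffunE ?eqxx //=; case: eqP nb.
Qed.

Lemma sem_Then (p1 p2 : tprog) rho (h : state m) :
  sem (Then p1 p2) rho h = sem p2 rho (sem p1 rho h).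
Proof. by []. Qed.

Lemma sem_For i (p1 : tprog) rho (h : state m) :
  sem (For i p1) rho h = foldl (fun h a => sem p1 (repoint rho i a) h) h (enum 'I_m.+1).
Proof. by []. Qed.

Lemma sem_Emit e rho (h : state m) : sem (Emit _ e) rho h = do_emit e h.
Proof. by []. Qed.

Definition semE := (sem_Then, sem_Read, sem_WriteEdge, sem_WriteNext, sem_WriteSeen,
  sem_WriteFresh, sem_WriteHere).

Definition ptr0 : 'I_5 := @Ordinal 5 0 isT.
Definition ptr1 : 'I_5 := @Ordinal 5 1 isT.
Definition ptr2 : 'I_5 := @Ordinal 5 2 isT.
Definition ptr3 : 'I_5 := @Ordinal 5 3 isT.
Definition ptr4 : 'I_5 := @Ordinal 5 4 isT.

Definition keep (u : regs) (_ : tcell) : regs := u.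

(** * The program that builds the bouquet *)

Definition with_bit_a u b := Regs (set_a u) (set_b u) (reg_a u) (reg_b u) (found u) b (bit_b u).

(* The loop visits q in increasing order, so that [bit_a], the outcome of the
   previous comparison of q with p, tells whether q is the successor of p. *)
Definition graph_body : tprog :=
  Then (WriteHere ptr1 (fun u c => Regs (set_a u) (set_b u) (cmark c) (reg_b u) (found u)
                                  (bit_a u) (bit_b u)) (fun _ _ => true))
  (Then (Read ptr0 ptr0 (fun u c => Regs (set_a u) (set_b u) (reg_a u) (cmark c) (found u)
                                  (bit_a u) (chere c)))
  (Then (WriteHere ptr1 keep (fun _ _ => false))
  (Then (WriteEdge ptr1 ptr0 keep (fun u c => cedge c :|:
           [set x | [|| bit_b u && (x == None),
                        [&& reg_a u == None, reg_b u == None & x == None]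
                      | bit_a u && (x == reg_b u)]]))
        (WriteEdge ptr0 ptr1 (fun u _ => with_bit_a u (bit_b u)) (fun u c => cedge c :|:
           [set x | bit_a u && (x == short_inv (reg_b u))]))))).

Definition graph_prog : tprog :=
  For ptr1 (Then (Read ptr1 ptr1 (fun u _ => with_bit_a u false)) (For ptr0 graph_body)).

Definition nowhere p : bool := false.

Definition add_edge E p q D := upd2 E p q (E p q :|: D).

Lemma in_add_edge E p q D a b x :
  (x \in add_edge E p q D a b) = (x \in E a b) || [&& a == p, b == q & x \in D].
Proof.
rewrite /add_edge /upd2; case: eqP => [->|]; last by rewrite orbF.
by case: eqP => [->|]; rewrite ?inE ?orbF.
Qed.

Definition forward_edges p q (next : bool) : labels :=
  [set x | [|| (p == q) && (x == None), [&& mk p == None, mk q == None & x == None]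
             | next && (x == mk q)]].

Definition backward_edges q (next : bool) : labels :=
  [set x | next && (x == short_inv (mk q))].

(** Pointers are compared through the table: the diagonal cell of p is marked in [chere], that of q
    is read, and the mark is erased. *)
Lemma sem_graph_body rho p q u E O N X o : rho ptr1 = p -> rho ptr0 = q ->
  exists u', [/\ found u' = found u, bit_a u' = (p == q) &
    sem graph_body rho (u, tab E O N X nowhere, o) =
    (u', tab (add_edge (add_edge E p q (forward_edges p q (bit_a u))) q p
               (backward_edges q (bit_a u))) O N X nowhere, o)].
Proof.
move=> r1 r0; rewrite /graph_body !semE r1 r0 !tabE /=; eexists; split; last first.
  congr (_, _, _); apply: eq_tab => // a; last first.
    by rewrite /upd1 /nowhere; case: eqP.
  move=> b; rewrite /add_edge /forward_edges /backward_edges /upd1 /=.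
  by rewrite -/(upd1 nowhere p true q) /upd1 /nowhere eq_sym; case: (p == q).
- by rewrite /upd1 /nowhere /= eq_sym; case: eqP.
by [].
Qed.

Definition mem_le E E' := forall p q, E p q \subset E' p q.

Lemma sem_graph_prog rho u O N X o :
  exists u' E, [/\ found u' = found u,
    sem graph_prog rho (u, tab (fun _ _ => set0) O N X nowhere, o) = (u', tab E O N X nowhere, o)
    & E =2 bouquet mk].
Proof.
(* The visit of (p, q) contributes to [E p q] and to [E q p]; so [E a b] is complete once both (a,
   b) and (b, a) have been visited. *)
pose done E p q := forward_edges p q (q == p.+1 :> nat) \subset E p q /\
                   backward_edges q (q == p.+1 :> nat) \subset E q p.
pose inv E := forall a b, E a b \subset bouquet mk a b.
pose I (k : nat) (h : state m) := exists u' E, [/\ found u' = found u,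
   h = (u', tab E O N X nowhere, o), inv E & forall a b : vertex, a < k -> done E a b].
have done_add E a b c d D : done E a b -> done (add_edge E c d D) a b.
  case=> f g; split; apply/subsetP=> x xD; rewrite in_add_edge;
    by rewrite ?(subsetP f) ?(subsetP g).
suff [u' [E [fu hE iE dE]]] : I m.+1 (sem graph_prog rho
    (u, tab (fun _ _ => set0) O N X nowhere, o)).
  exists u', E; split=> // a b; apply/eqP; rewrite eqEsubset iE /=.
  have [fE _] := dE a b (ltn_ord a); have [_ gE] := dE b a (ltn_ord b).
  apply/subsetP=> x; rewrite inE => /or4P xE; case: xE => xE;
    by [apply: (subsetP fE); rewrite inE xE ?orbT | apply: (subsetP gE); rewrite inE].
rewrite sem_For; apply: foldl_enum_ind.
  by exists u, (fun _ _ => set0); split=> // a b; rewrite sub0set.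
move=> p _ [u1 [E1 [fu1 -> iE1 dE1]]].
rewrite sem_Then sem_Read sem_For.
pose J (k : nat) (h : state m) := exists u' E, [/\ found u' = found u,
   bit_a u' = (k == p.+1), h = (u', tab E O N X nowhere, o), inv E &
   forall a b : vertex, (a < p) || (a == p) && (b < k) -> done E a b].
set h := foldl _ _ _.
suff [u' [E [fu' _ -> iE dE]]] : J m.+1 h.
  exists u', E; split=> // a b; rewrite ltnS leq_eqVlt => /orP[/eqP/val_inj->|ap].
    by apply: dE; rewrite eqxx ltn_ord orbT.
  by apply: dE; rewrite ap.
apply: foldl_enum_ind.
  exists (with_bit_a u1 false), E1; split=> // a b.
  by rewrite ltn0 andbF orbF; apply: dE1.
move=> q _ [u2 [E2 [fu2 bu2 -> iE2 dE2]]].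
have [||u3 [fu3 bu3 ->]] := @sem_graph_body (repoint (repoint rho ptr1 p) ptr0 q) p q u2 E2 O N X o.
  by [].
  by [].
rewrite bu2; set n := _ == _ :> nat.
exists u3, (add_edge (add_edge E2 p q (forward_edges p q n)) q p (backward_edges q n)).
split; last 1 first.
- move=> a b; have [/andP[/eqP-> /eqP->] _|nab] := boolP ((a == p) && (b == q)).
    split; apply/subsetP=> x xD; rewrite !in_add_edge !eqxx xD ?orbT //.
  rewrite ltnS (leq_eqVlt b) => lt_ab.
  apply/done_add/done_add/dE2; move: lt_ab nab.
  by rewrite -(val_eqE b q) /=; case: (a < p) => //; case: (a == p) => //; case: (b == q :> nat).
- by rewrite fu3.
- by rewrite bu3 eqSS eq_sym.
- by [].
move=> a b; apply/subsetP=> x; rewrite !in_add_edge => /orP[/orP[xE|]|].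
- exact: subsetP (iE2 a b) x xE.
- case/and3P=> /eqP-> /eqP->; rewrite !inE; case/or3P=> ->; rewrite ?orbT //.
case/and3P=> /eqP-> /eqP->; rewrite !inE => ->; rewrite ?orbT //.
Qed.

(** * The saturation program *)

Definition label_product (a b : labels) : labels :=
  [set z | [exists x in a, [exists y in b, short_mul x y == Some z]]].

Lemma label_productP (a b : labels) z :
  reflect (exists x y, [/\ x \in a, y \in b & short_mul x y = Some z]) (z \in label_product a b).
Proof.
rewrite inE; apply: (iffP exists_inP) => [[x xa /exists_inP[y yb /eqP]]|[x [y [xa yb xy]]]].
  by exists x, y.
by exists x => //; apply/exists_inP; exists y => //; apply/eqP.
Qed.

Definition saturate_body : tprog :=
  Then (Read ptr2 ptr1 (fun u c => Regs (cedge c) (set_b u) (reg_a u) (reg_b u) (found u)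
                                 (bit_a u) (bit_b u)))
  (Then (Read ptr1 ptr0 (fun u c => Regs (set_a u) (cedge c) (reg_a u) (reg_b u) (found u)
                                 (bit_a u) (bit_b u)))
        (WriteEdge ptr2 ptr0 keep (fun u c => cedge c :|: label_product (set_a u) (set_b u)))).

Definition saturate_round : tprog := For ptr2 (For ptr1 (For ptr0 saturate_body)).

Fixpoint repeat_prog k (p1 : tprog) : tprog :=
  if k is k'.+1 then Then p1 (repeat_prog k' p1) else p1.

(** Pointers 3 and 4 only count, giving [m.+1 * m.+1] rounds. [repeat_prog] runs these once more
    than there are short words, which exceeds the number of possible labelled edges. *)
Definition saturate_prog : tprog :=
  repeat_prog #|{: short}| (For ptr4 (For ptr3 saturate_round)).

Definition saturate_step p q r E := add_edge E p r (label_product (E p q) (E q r)).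

Definition saturate_all E :=
  foldl (fun E p => foldl (fun E q => foldl (fun E r => saturate_step p q r E)
    E (enum 'I_m.+1)) E (enum 'I_m.+1)) E (enum 'I_m.+1).

Definition edge_state O N X o f (h : state m) E :=
  exists u, found u = f /\ h = (u, tab E O N X nowhere, o).

Lemma sem_saturate_round O N X o f rho h E :
  edge_state O N X o f h E ->
  edge_state O N X o f (sem saturate_round rho h) (saturate_all E).
Proof.
rewrite /saturate_round /saturate_all sem_For => hE.
apply: (foldl_rel (R := edge_state O N X o f) _ hE) => {hE} h1 E1 p; rewrite sem_For => hE.
apply: (foldl_rel (R := edge_state O N X o f) _ hE) => {hE} h2 E2 q; rewrite sem_For => hE.
apply: (foldl_rel (R := edge_state O N X o f) _ hE) => {hE} h3 E3 r [u [fu ->]].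
by rewrite /saturate_body !semE !tabE /keep /=; eexists; split; last reflexivity.
Qed.

Lemma sem_repeat_prog k (p1 : tprog) rho (h : state m) :
  sem (repeat_prog k p1) rho h = iter k.+1 (sem p1 rho) h.
Proof. by elim: k h => //= k IH h; rewrite IH -iterSr. Qed.

Lemma sem_saturate_prog O N X o f rho h E :
  edge_state O N X o f h E ->
  edge_state O N X o f (sem saturate_prog rho h)
    (iter (#|{: short}|.+1 * (m.+1 * m.+1)) saturate_all E).
Proof.
rewrite /saturate_prog sem_repeat_prog.
have rounds h' E' rho' : edge_state O N X o f h' E' ->
    edge_state O N X o f (sem (For ptr4 (For ptr3 saturate_round)) rho' h')
      (iter (m.+1 * m.+1) saturate_all E').
  move=> hE; have -> : iter (m.+1 * m.+1) saturate_all E' =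
      foldl (fun E _ => foldl (fun E _ => saturate_all E) E (enum 'I_m.+1)) E' (enum 'I_m.+1).
    rewrite foldl_const size_enum_ord iterM; apply: eq_iter => E1.
    by rewrite foldl_const size_enum_ord.
  rewrite sem_For; apply: (foldl_rel (R := edge_state O N X o f) _ hE) => {hE} h1 E1 p.
  rewrite sem_For => hE.
  by apply: (foldl_rel (R := edge_state O N X o f) _ hE) => {hE} h2 E2 q; apply: sem_saturate_round.
move=> hE; rewrite iterM; elim: _.+1 => //= n IH; exact: rounds.
Qed.

Lemma saturate_all_inv (P : (vertex -> vertex -> labels) -> Prop) E :
  (forall p q r E, P E -> P (saturate_step p q r E)) -> P E -> P (saturate_all E).
Proof.
move=> Ps PE; apply: (foldl_inv _ PE) => E1 p PE1; apply: (foldl_inv _ PE1) => E2 q PE2.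
by apply: (foldl_inv _ PE2) => E3 r PE3; apply: Ps.
Qed.

Lemma mem_le_add E E' p q D : mem_le E E' -> mem_le E (add_edge E' p q D).
Proof. by move=> le a b; apply/subsetP=> x xE; rewrite in_add_edge (subsetP (le a b)). Qed.

Lemma saturate_all_le E : mem_le E (saturate_all E).
Proof. by apply: (@saturate_all_inv (mem_le E)) => // p q r E'; apply: mem_le_add. Qed.

Lemma label_productS (a a' b b' : labels) :
  a \subset a' -> b \subset b' -> label_product a b \subset label_product a' b'.
Proof.
move=> /subsetP aa /subsetP bb; apply/subsetP=> z /label_productP[x [y [xa yb xy]]].
by apply/label_productP; exists x, y; split; auto.
Qed.

(** The labels change during the round but only grow, so the product formed at the visit of (p, q,
    r) contains the one taken before the round. *)
Lemma saturate_all_product E p q r : label_product (E p q) (E q r) \subset saturate_all E p r.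
Proof.
pose Q E' := label_product (E p q) (E q r) \subset E' p r.
have Qs p' q' r' E' : Q E' -> Q (saturate_step p' q' r' E').
  by move=> QE; apply: subset_trans QE _; apply/subsetP=> x xE; rewrite in_add_edge xE.
have Ps p' q' r' E' : mem_le E E' -> mem_le E (saturate_step p' q' r' E').
  exact: mem_le_add.
apply: (foldl_hit (mem_le E) Q _ _ _ _ (mem_enum _ p)) => //.
- move=> E1 p' PE1; left; apply: (foldl_inv _ PE1) => E2 q' PE2.
  by apply: (foldl_inv _ PE2) => E3 r'; apply: Ps.
- move=> E1 p' QE1; apply: (foldl_inv (P := Q) _ QE1) => E2 q' QE2.
  by apply: (foldl_inv (P := Q) _ QE2) => E3 r'; apply: Qs.
move=> E1 PE1; apply: (foldl_hit (mem_le E) Q _ _ _ _ (mem_enum _ q)) => //.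
- by move=> E2 q' PE2; left; apply: (foldl_inv _ PE2) => E3 r'; apply: Ps.
- by move=> E2 q' QE2; apply: (foldl_inv (P := Q) _ QE2) => E3 r'; apply: Qs.
move=> E2 PE2; apply: (foldl_hit (mem_le E) Q _ _ _ _ (mem_enum _ r)) => //.
- by move=> E3 r' PE3; left; apply: Ps.
- by move=> E3 r'; apply: Qs.
move=> E3 PE3; apply/subsetP=> z zE; rewrite in_add_edge !eqxx /=.
by rewrite (subsetP (label_productS (PE3 p q) (PE3 q r))) ?orbT.
Qed.

Definition product_closed E := forall p q r, label_product (E p q) (E q r) \subset E p r.

Definition edge_set E : {set vertex * vertex * short} := [set t | t.2 \in E t.1.1 t.1.2].

Lemma saturate_all_closed E : product_closed E -> saturate_all E =2 E.
Proof.
move=> cE p q; apply/eqP; rewrite eqEsubset saturate_all_le andbT.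
apply: (@saturate_all_inv (fun E' => forall p q, E' p q \subset E p q)) => // {}p {}q r E' E'E a b.
apply/subsetP=> z; rewrite in_add_edge => /orP[zE|/and3P[/eqP-> /eqP-> zE]].
  exact: subsetP (E'E a b) z zE.
by rewrite (subsetP (cE p q r)) // (subsetP (label_productS (E'E p q) (E'E q r))).
Qed.

Lemma product_closed_eq E E' : E =2 E' -> product_closed E -> product_closed E'.
Proof. by move=> EE cE p q r; rewrite -!EE. Qed.

(** A round that adds no labelled edge has added every product, so its graph is closed; every other
    round increases the number of labelled edges. *)
Lemma iter_saturate n E :
  product_closed (iter n saturate_all E) \/ n <= #|edge_set (iter n saturate_all E)|.
Proof.
elim: n => [|n [cE|IH]]; first by right.
  by left; rewrite iterS; apply: (product_closed_eq _ cE) => p q; rewrite saturate_all_closed.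
set E1 := iter n _ _ in IH *; rewrite iterS -/E1.
have sub : edge_set E1 \subset edge_set (saturate_all E1).
  by apply/subsetP=> t; rewrite !inE; apply/subsetP/saturate_all_le.
have [eqE|neq] := eqVneq (edge_set E1) (edge_set (saturate_all E1)).
  have EE : E1 =2 saturate_all E1.
    by move=> p q; apply/setP=> x; have /setP/(_ (p, q, x)) := eqE; rewrite !inE.
  left; apply: (product_closed_eq EE) => p q r.
  by rewrite (EE p r); apply: saturate_all_product.
by right; apply: leq_ltn_trans IH _; apply: proper_card; rewrite properEneq neq.
Qed.

Lemma saturate_prog_closed E :
  product_closed (iter (#|{: short}|.+1 * (m.+1 * m.+1)) saturate_all E).
Proof.
have [//|] := iter_saturate (#|{: short}|.+1 * (m.+1 * m.+1)) E.
move/leq_trans/(_ (max_card _)); rewrite card_prod card_prod card_ord.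
by rewrite [X in _ <= X]mulnC leq_pmul2r ?muln_gt0 // ltnn.
Qed.

Lemma iter_saturate_inv (P : (vertex -> vertex -> labels) -> Prop) n E :
  (forall p q r E, P E -> P (saturate_step p q r E)) -> P E -> P (iter n saturate_all E).
Proof. by move=> Ps PE; elim: n => //= n IH; apply: saturate_all_inv. Qed.

(** * Breadth-first search over vertices and first letters *)

Definition discovered (e a b : labels) : {set letter A} :=
  [set l | [&& Some l \in e, Some l \notin b & [exists y in a, y != Some (inv_letter l)]]].

Definition continuation (a : labels) l : option short :=
  [pick y in a | y != Some (inv_letter l)].

Definition first_letter (a : labels) : short := [pick l | Some l \in a].

(* [cseen] at a vertex p holds the first letters of the reduced words spelled from
   p to the base vertex, and [None] for the empty word if p is the base vertex.
   Discoveries wait in [cfresh] until the end of the round, which makes the rounds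
   the layers of a breadth-first search. *)
Definition bfs_body : tprog :=
  Then (Read ptr0 ptr0 (fun u c => Regs (cseen c) (set_b u) (reg_a u) (reg_b u) (found u)
                                 (bit_a u) (bit_b u)))
  (Then (Read ptr1 ptr1 (fun u c => Regs (set_a u) (cseen c) (reg_a u) (reg_b u) (found u)
                                 (bit_a u) (bit_b u)))
  (Then (WriteNext ptr1 ptr0
           (fun u c => Regs (set_a u) (Some @: discovered (cedge c) (set_a u) (set_b u))
                         (reg_a u) (reg_b u) (found u) (bit_a u) (bit_b u))
           (fun u c => [ffun l => if l \in discovered (cedge c) (set_a u) (set_b u)
                                  then continuation (set_a u) l else cnext c l]))
        (WriteFresh ptr1 keep (fun u c => cfresh c :|: set_b u)))).

(** Membership of [None] in [cseen] recognizes the base vertex. Once set, [found] is never changed: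
    it keeps a letter of the earliest round, whence minimality. *)
Definition merge_body : tprog :=
  WriteSeen ptr0
    (fun u c => Regs (set_a u) (set_b u) (reg_a u) (reg_b u)
      (if (None \in cseen c) && (found u == None)
       then first_letter (cseen c :|: cfresh c) else found u) (bit_a u) (bit_b u))
    (fun u c => cseen c :|: cfresh c).

Definition bfs_round : tprog := Then (For ptr1 (For ptr0 bfs_body)) (For ptr0 merge_body).

Definition bfs_prog : tprog := For ptr2 bfs_round.

Section Search.
Variables (E : vertex -> vertex -> labels) (o : seq S).

Definition bfs_state f O N X (h : state m) :=
  exists u, found u = f /\ h = (u, tab E O N X nowhere, o).

Lemma sem_bfs_body rho p q f O N X h : rho ptr1 = p -> rho ptr0 = q ->
  bfs_state f O N X h ->
  let D := discovered (E p q) (O q) (O p) in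
  bfs_state f O (upd1 N p (N p :|: (Some @: D)))
    (upd2 X p q [ffun l => if l \in D then continuation (O q) l else X p q l])
    (sem bfs_body rho h).
Proof.
move=> r1 r0 [u [fu ->]] D; rewrite /bfs_body !semE r1 r0 !tabE /keep /=.
by eexists; split; last reflexivity.
Qed.

(* [rk] ranks the pairs of a vertex and a first letter by their round of
   discovery; it decreases along recorded continuations. *)
Definition bfs_inv k f O N X :=
  [/\ forall p, (None \in O p) = (p == ord0),
      forall p, N p \subset O p,
      forall p w, size w <= k -> reduced w -> leads_to ord0 E p w -> ohead w \in O p
    & exists rk : vertex -> short -> nat,
      [/\ forall p x, x \in O p -> rk p x <= k,
          forall p l, Some l \in O p -> exists q y, X p q l = Some y,
          forall p q l y, X p q l = Some y ->
            [/\ Some l \in O p, Some l \in E p q, y != Some (inv_letter l), y \in O q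
              & rk q y < rk p (Some l)]
        & if f is Some l then
            Some l \in O ord0 /\
            forall w, w != [::] -> reduced w -> leads_to ord0 E ord0 w ->
              rk ord0 (Some l) <= size w
          else forall l, Some l \notin O ord0]].

(** [O] is frozen while a round discovers. New pairs get continuations that lie in [O], hence of
    smaller rank, while those of the pairs already seen stay as in [X0]. *)
Definition discovery_inv O X0 N X :=
  [/\ forall p x, x \in N p -> x \in O p \/
        exists l, x = Some l /\ exists q y, X p q l = Some y,
      forall p q l y, X p q l = Some y -> Some l \notin O p ->
        [/\ Some l \in N p, Some l \in E p q, y != Some (inv_letter l) & y \in O q]
    & forall p q l, Some l \in O p -> X p q l = X0 p q l].

Definition discovery_done O p q N := forall l y,
  Some l \in E p q -> y \in O q -> y != Some (inv_letter l) -> Some l \in O p :|: N p.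

(** In the search, [e] holds the labels from p to q, and [a] and [b] are the seen sets of q and p.
    The element [None] of [a] stands for the empty word and clashes with no letter. *)
Lemma discoveredP (e a b : labels) l :
  reflect [/\ Some l \in e, Some l \notin b &
             exists y, [/\ continuation a l = Some y, y \in a & y != Some (inv_letter l)]]
    (l \in discovered e a b).
Proof.
rewrite inE; apply: (iffP and3P) => [[le lb /exists_inP[y ya yl]]|[le lb [y [_ ya yl]]]].
  split=> //; rewrite /continuation; case: pickP => [z /andP[za zl]|/(_ y)]; first by exists z.
  by rewrite ya yl.
by split=> //; apply/exists_inP; exists y.
Qed.

Lemma sem_bfs_body_inv rho p q f O N X X0 h : rho ptr1 = p -> rho ptr0 = q ->
  bfs_state f O N X h -> discovery_inv O X0 N X ->
  exists N' X', [/\ bfs_state f O N' X' (sem bfs_body rho h), discovery_inv O X0 N' X',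
    discovery_done O p q N' & forall a, N a \subset N' a].
Proof.
move=> r1 r0 st [iN iX iO]; have := sem_bfs_body r1 r0 st.
set D := discovered _ _ _ => /=; set N' := upd1 _ _ _; set X' := upd2 _ _ _ _ => st'.
have NN' a : N a \subset N' a.
  by rewrite /N' /upd1; case: eqP => [->|_] //; apply: subsetUl.
have DN' l : l \in D -> Some l \in N' p.
  by move=> lD; rewrite /N' /upd1 eqxx inE imset_f ?orbT.
have X'D l : l \in D -> X' p q l = continuation (O q) l.
  by move=> lD; rewrite /X' /upd2 !eqxx ffunE lD.
have X'E a b l : ~~ [&& a == p, b == q & l \in D] -> X' a b l = X a b l.
  rewrite /X' /upd2; case: eqP => [->|] //; case: eqP => [->|] //=.
  by rewrite ffunE => /negPf->.
exists N', X'; split=> //; last first.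
  move=> l y le yq yl; rewrite inE; have [//|lO] := boolP (Some l \in O p).
  by rewrite DN' //; rewrite inE le lO; apply/exists_inP; exists y.
split.
- have X'ex a l : (exists b y, X a b l = Some y) -> exists b y, X' a b l = Some y.
    case=> b [y Xy]; have [/and3P[/eqP-> /eqP _ lD]|nD] := boolP [&& a == p, b == q & l \in D].
      by have /discoveredP[_ _ [z [zE _ _]]] := lD; exists q, z; rewrite X'D.
    by exists b, y; rewrite X'E.
  have iN' a x : x \in N a -> x \in O a \/
      exists l, x = Some l /\ exists b y, X' a b l = Some y.
    by case/iN=> [|[l [-> lX]]]; [left | right; exists l; split; last exact: X'ex].
  move=> a x; rewrite /N' /upd1; case: eqP => [->|_]; last exact: iN'.
  rewrite inE => /orP[|/imsetP[l lD ->]]; first exact: iN'.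
  right; exists l; split=> //; have /discoveredP[_ _ [z [zE _ _]]] := lD.
  by exists q, z; rewrite X'D.
- move=> a b l y; have [/and3P[/eqP-> /eqP-> lD]|nD] := boolP [&& a == p, b == q & l \in D].
    rewrite X'D // => cE _; rewrite DN' //; have /discoveredP[le _ [z [zE zq zl]]] := lD.
    by move: cE; rewrite zE => -[<-].
  rewrite X'E // => Xy lO; have [lN le yl yb] := iX _ _ _ _ Xy lO.
  by split=> //; apply: subsetP lN.
move=> a b l lO; rewrite X'E ?iO //; apply/negP=> /and3P[/eqP ap _].
by case/discoveredP; rewrite -ap lO.
Qed.

Lemma sem_discovery rho f O N X0 h :
  bfs_state f O N X0 h -> discovery_inv O X0 N X0 ->
  exists N' X, [/\ bfs_state f O N' X (sem (For ptr1 (For ptr0 bfs_body)) rho h),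
    discovery_inv O X0 N' X & forall p q, discovery_done O p q N'].
Proof.
move=> st0 inv0.
pose I (h : state m) := exists N X, bfs_state f O N X h /\ discovery_inv O X0 N X.
pose J (K : vertex -> vertex -> Prop) (h : state m) := exists N X,
  [/\ bfs_state f O N X h, discovery_inv O X0 N X &
      forall p q : vertex, K p q -> discovery_done O p q N].
suff [N' [X [st inv dn]]] : J (fun a _ => a < m.+1) (sem (For ptr1 (For ptr0 bfs_body)) rho h).
  by exists N', X; split=> // p q; apply: dn.
rewrite sem_For; apply: (foldl_enum_ind (P := fun k => J (fun a _ => a < k))).
  by exists N, X0.
move=> p h1 [N1 [X1 [st1 inv1 dn1]]]; rewrite sem_For.
set h2 := foldl _ _ _.
suff [N2 [X2 [st2 inv2 dn2]]] : J (fun a b => (a < p) || (a == p) && (b < m.+1)) h2.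
  exists N2, X2; split=> // a b; rewrite ltnS (leq_eqVlt a) => ab; apply: dn2.
  by rewrite ltn_ord andbT orbC -val_eqE.
apply: (foldl_enum_ind (P := fun k => J (fun a b => (a < p) || (a == p) && (b < k)))).
  by exists N1, X1; split=> // a b; rewrite andbF orbF; apply: dn1.
move=> q h3 [N3 [X3 [st3 inv3 dn3]]].
have [//|//|N4 [X4 [st4 inv4 dn4 sub]]] :=
  sem_bfs_body_inv (rho := repoint (repoint rho ptr1 p) ptr0 q) (p := p) (q := q) _ _ st3 inv3.
exists N4, X4; split=> // a b.
rewrite ltnS (leq_eqVlt b) andb_orr orbCA => /orP[/andP[/eqP-> /eqP/val_inj->] //|ab].
move=> l y le yb yl; have := dn3 a b ab l y le yb yl.
by apply/subsetP/setUS.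
Qed.

Definition final_found f (a : labels) := if f is Some l then f else first_letter a.

Lemma sem_merge rho f O N X h :
  (forall p, (None \in O p) = (p == ord0)) ->
  bfs_state f O N X h ->
  exists O', (forall p, O' p = O p :|: N p) /\
    bfs_state (final_found f (O ord0 :|: N ord0)) O' N X (sem (For ptr0 merge_body) rho h).
Proof.
move=> O0 st0.
(* The base vertex is vertex 0, so [found] is settled by the first iteration. *)
pose I k (h : state m) := exists O' f', [/\ bfs_state f' O' N X h,
  f' = (if k is 0 then f else final_found f (O ord0 :|: N ord0)) &
  forall p : vertex, O' p = if p < k then O p :|: N p else O p].
suff [O' [f' [st fE OE]]] : I m.+1 (sem (For ptr0 merge_body) rho h).
  by exists O'; split=> [p|]; [rewrite OE ltn_ord | rewrite -fE].
rewrite sem_For; apply: foldl_enum_ind.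
  by exists O, f.
move=> p h1 [O1 [f1 [[u [uE ->]] f1E O1E]]].
rewrite /merge_body semE [repoint _ _ _ _]/= !tabE.
have O1p : O1 p = O p by rewrite O1E ltnn.
eexists; eexists; split; first by eexists; split; last reflexivity.
- rewrite /= O1p O0 uE f1E /final_found; case: p {f1E O1E O1p} => -[|p] lt_p.
    by rewrite -val_eqE /=; case: (f) => [l|] //=;
      congr (first_letter (O _ :|: N _)); apply: val_inj.
  by rewrite -val_eqE.
move=> a; rewrite /upd1 -(inj_eq val_inj) ltnS leq_eqVlt; case: eqP => [/val_inj->|_] /=.
  by rewrite O1p.
by rewrite O1E.
Qed.

(** Pairs discovered in this round get rank [k.+1], above their continuations, which were seen
    before. A word of [k.+1] letters is caught through its tail, whose first letter was seen by
    completeness up to length [k]. *)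
Lemma sem_bfs_round rho k f O N X h :
  bfs_state f O N X h -> bfs_inv k f O N X ->
  exists f' O' N' X', bfs_state f' O' N' X' (sem bfs_round rho h) /\ bfs_inv k.+1 f' O' N' X'.
Proof.
move=> st [O0 NO complete [rk [rkO nextO rkX rkf]]].
have inv0 : discovery_inv O X N X.
  split=> // [p x xN|p q l y /rkX[lO _ _ _ _]]; last by rewrite lO.
  by left; apply: subsetP (NO p) x xN.
have [N' [X' [st1 [iN iX iO] dn]]] := sem_discovery rho st inv0.
have [O' [O'E st2]] := sem_merge rho O0 st1.
exists (final_found f (O ord0 :|: N' ord0)), O', N', X'.
split; first by rewrite /bfs_round sem_Then.
have complete' p w : size w <= k.+1 -> reduced w -> leads_to ord0 E p w -> ohead w \in O' p.
  case: w => [_ _ /= ->|l w /= sw rw [q le qw]]; first by rewrite O'E inE O0 eqxx.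
  rewrite O'E; apply: (dn p q l (ohead w)) => //.
    by apply: complete => //; apply: path_sorted rw.
  by case: (w) rw => //= l' w' /andP[ll' _]; apply: contra ll' => /eqP[->].
pose rk' p x := if x \in O p then rk p x else k.+1.
have rkO0 l : Some l \in O ord0 -> rk' ord0 (Some l) = rk ord0 (Some l).
  by rewrite /rk' => ->.
split=> //.
- move=> p; rewrite O'E inE O0; case: eqP => //= p0; apply/negP=> /iN[|[l [//]]].
  by rewrite O0 => /eqP.
- by move=> p; rewrite O'E subsetUr.
have rkO' p x : rk' p x <= k.+1.
  by rewrite /rk'; case: ifP => // /rkO rkk; apply: leqW.
exists rk'; split=> [p x _|p l||]; first exact: rkO'.
- rewrite O'E inE => lO; have [lO1|nO] := boolP (Some l \in O p).
    by have [q [y Xy]] := nextO p l lO1; exists q, y; rewrite iO.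
  by move: lO; rewrite (negPf nO) /= => /iN[|[l' [[<-] //]]]; rewrite (negPf nO).
- move=> p q l y; rewrite /rk' O'E !inE.
  have [lO|lO] := boolP (Some l \in O p).
    rewrite iO // => /rkX[_ le yl yq rkl]; split=> //; last by rewrite yq.
    by rewrite O'E inE yq.
  move=> /iX/(_ lO)[lN le yl yq]; split=> //; first by rewrite O'E inE yq.
  by rewrite yq ltnS; apply: rkO.
case: f rkf {st st1 st2} => [l [lO min]|none] /=.
  split; first by rewrite O'E inE lO.
  by move=> w w0 rw lw; rewrite rkO0 //; apply: min.
rewrite /first_letter; case: pickP => [l lO'|none'].
  split; first by rewrite O'E.
  (* A word of at most [k] letters would already have put its first letter into [O ord0], so the new
     letter, of rank at most [k.+1], is minimal. *)
  move=> w w0 rw lw; have [sw|] := leqP (size w) k.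
    have := complete _ _ sw rw lw; case: (w) w0 => //= l' w' _.
    by rewrite (negPf (none l')).
  exact: leq_trans.
by move=> l; rewrite O'E none'.
Qed.

Lemma sem_bfs_prog rho f O N X h :
  bfs_state f O N X h -> bfs_inv 0 f O N X ->
  exists f' O' N' X', bfs_state f' O' N' X' (sem bfs_prog rho h) /\ bfs_inv m.+1 f' O' N' X'.
Proof.
move=> st inv; rewrite /bfs_prog sem_For.
apply: (foldl_enum_ind (P := fun k h => exists f O N X, bfs_state f O N X h /\ bfs_inv k f O N X)).
  by exists f, O, N, X.
by move=> p h1 [f1 [O1 [N1 [X1 [st1 inv1]]]]]; apply: sem_bfs_round st1 inv1.
Qed.

(* [chere] marks the current vertex of the walk along recorded continuations. *)
Definition start_body : tprog :=
  WriteHere ptr0 (fun u c => Regs (set_a u) (set_b u) (found u) (reg_b u) (found u)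
                             (bit_a u) (bit_b u)) (fun u c => None \in cseen c).

Definition walk_next (u : regs) (c : tcell) : option short :=
  if bit_a u then obind (cnext c) (reg_a u) else None.

(** [reg_a] is the next letter to spell. When the walk moves, [reg_b] receives the letter just
    spelled and tells the remaining instructions to act. The old mark is erased before the new one
    is set, as the two vertices may coincide. *)
Definition walk_body : tprog :=
  Then (Read ptr1 ptr1 (fun u c => Regs (set_a u) (set_b u) (reg_a u) (reg_b u) (found u)
                                 (chere c) (bit_b u)))
  (Then (Read ptr1 ptr0 (fun u c => if walk_next u c is Some y
           then Regs (set_a u) (set_b u) y (reg_a u) (found u) (bit_a u) (bit_b u)
           else Regs (set_a u) (set_b u) (reg_a u) None (found u) (bit_a u) (bit_b u)))
  (Then (WriteHere ptr1 keep (fun u c => if reg_b u is Some _ then false else chere c))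
  (Then (WriteHere ptr0 keep (fun u c => if reg_b u is Some _ then true else chere c))
        (Emit _ (fun u => omap inl (reg_b u)))))).

Definition walk_prog : tprog := For ptr2 (For ptr1 (For ptr0 walk_body)).

(** * Reading off the answer along recorded continuations *)

Section Walk.
Variables (f : short) (O N : vertex -> labels) (X : vertex -> vertex -> next_table).

Definition walk_state (h : state m) (t : vertex * short * word A) :=
  exists u, [/\ found u = f, reg_a u = t.1.2
    & h = (u, tab E O N X (fun a => a == t.1.1), map inl t.2)].

Definition walk_step p q (t : vertex * short * word A) : vertex * short * word A :=
  if t.1.1 == p then
    if t.1.2 is Some l then
      if X p q l is Some y then (q, y, rcons t.2 l) else t
    else t
  else t.

Definition walk_all t :=
  foldl (fun t p => foldl (fun t q => walk_step p q t) t (enum 'I_m.+1)) t (enum 'I_m.+1).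

Lemma sem_walk_body rho p q h t : rho ptr1 = p -> rho ptr0 = q ->
  walk_state h t -> walk_state (sem walk_body rho h) (walk_step p q t).
Proof.
case: t => [[pos x] w] r1 r0 [u [uf ux ->]].
rewrite /walk_body !sem_Then !sem_Read sem_WriteHere sem_WriteHere r1 r0 !tabE /=.
set u1 := Regs _ _ _ _ _ (p == pos) _; set c1 := tab _ _ _ _ _ (p, q).
have -> : walk_step p q (pos, x, w) =
    if walk_next u1 c1 is Some y then
      (q, y, if x is Some l then rcons w l else w)
    else (pos, x, w).
  rewrite /walk_step /walk_next /c1 tabE /= ux eq_sym; case: (p == pos) => //.
  by case: (x) => [l|] //=; case: (X p q l).
have : walk_next u1 c1 <> None -> p = pos /\ exists l, x = Some l.
  by rewrite /walk_next /= ux; case: eqP => // -> ; case: (x) => // l; split=> //; exists l.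
case: (walk_next u1 c1) => [y|] /=.
  case=> // pos_p [l xl]; rewrite xl in ux *.
  eexists; split; last first.
  - rewrite [X in do_emit X]/= /do_emit /= ux.
    congr (_, _, _); last by rewrite map_rcons.
    by apply: eq_tab => // a; rewrite /upd1 pos_p /=; case: eqP => // _; case: eqP.
  - by [].
  - exact: uf.
move=> _; eexists; split; last first.
- congr (_, _, _); apply: eq_tab => // a; rewrite /upd1.
  by case: (eqVneq a q) => [->|_]; case: eqP => // ->.
- exact: ux.
- exact: uf.
Qed.

Lemma sem_walk_prog rho h t : walk_state h t ->
  walk_state (sem walk_prog rho h) (iter m.+1 walk_all t).
Proof.
move=> st.
have -> : iter m.+1 walk_all t = foldl (fun t _ => walk_all t) t (enum 'I_m.+1).
  by rewrite foldl_const size_enum_ord.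
rewrite /walk_prog sem_For.
apply: (foldl_rel (R := walk_state) _ st) => {st} h1 t1 p1 st; rewrite sem_For.
apply: (foldl_rel (R := walk_state) _ st) => {st} h2 t2 p2 st; rewrite sem_For.
by apply: (foldl_rel (R := walk_state) _ st) => {st} h3 t3 p3 st; apply: sem_walk_body.
Qed.

Lemma walk_all_stop pos w : walk_all (pos, None, w) = (pos, None, w).
Proof.
apply: (foldl_inv (P := fun t => t = (pos, None, w))) => // t p ->.
apply: (foldl_inv (P := fun t => t = (pos, None, w))) => // t' q ->.
by rewrite /walk_step /=; case: ifP.
Qed.

Variables (k : nat) (l0 : letter A).
Hypothesis (inv : bfs_inv k (Some l0) O N X) (k_le : k <= m.+1).

Lemma walk_allP : exists w pos,
  [/\ iter m.+1 walk_all (ord0, Some l0, [::]) = (pos, None, w), reduced w, w != [::],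
      leads_to ord0 E ord0 w
    & forall w', w' != [::] -> reduced w' -> leads_to ord0 E ord0 w' -> size w <= size w'].
Proof.
have [O0 _ _ [rk [rkO nextO rkX [l0O min]]]] := inv.
(* Letters emitted plus remaining rank never exceed the rank of the start, which bounds every
   competitor from below. The last clause is stated for all continuations [w2], so that it survives
   a step and yields the answer at [w2 = [::]]. *)
pose winv (t : vertex * short * word A) :=
  [/\ t.1.2 \in O t.1.1, size t.2 + rk t.1.1 t.1.2 <= rk ord0 (Some l0)
    & forall w2, reduced w2 -> leads_to ord0 E t.1.1 w2 -> ohead w2 = t.1.2 ->
      [/\ reduced (t.2 ++ w2), leads_to ord0 E ord0 (t.2 ++ w2) & ohead (t.2 ++ w2) = Some l0]].
pose Q (t0 t : vertex * short * word A) := winv t /\ size t0.2 < size t.2.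
have move_on t p q l y : winv t -> t.1 = (p, Some l) -> X p q l = Some y ->
    Q t (q, y, rcons t.2 l).
  case: t => [[p1 x1] w] /= [xO sz cont] [pE xE] Xl; subst p1 x1.
  rewrite /Q /winv /= size_rcons ltnS.
  have [lO le yl yq rkl] := rkX _ _ _ _ Xl; split=> //; split=> //.
    by apply: leq_trans sz; rewrite addSnnS leq_add2l.
  move=> w2 rw2 lw2 w2y; rewrite cat_rcons; apply: cont => //; last by exists q.
  case: w2 rw2 w2y {lw2} => //= l2 w2 rw2 w2y; rewrite rw2 andbT.
  by apply: contra yl => /eqP<-; rewrite -w2y.
have stepP t p q : winv t -> walk_step p q t = t \/ Q t (walk_step p q t).
  move=> tI; rewrite /walk_step; case: eqP => [tp|]; last by left.
  case tx: t.1.2 => [l|]; last by left.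
  case Xl: (X p q l) => [y|]; last by left.
  by right; apply: move_on Xl => //; rewrite -tp -tx; case: (t.1).
have stepQ t0 t p q : Q t0 t -> Q t0 (walk_step p q t).
  by case=> tI lt; have [->|[tI' lt']] := stepP t p q tI; split=> //; apply: ltn_trans lt'.
have step0 t p q t' : winv t -> t' = t -> walk_step p q t' = t \/ Q t (walk_step p q t').
  by move=> tI ->; apply: stepP.
have rowQ t0 t p : Q t0 t -> Q t0 (foldl (fun t q => walk_step p q t) t (enum 'I_m.+1)).
  by apply: foldl_inv => t1 q; apply: stepQ.
have progress t l : winv t -> t.1.2 = Some l -> Q t (walk_all t).
  move=> tI tx; case: t tI tx => [[p x] w] tI /= xE; subst x; set t := (p, Some l, w) in tI *.
  have [q [y Xl]] : exists q y, X p q l = Some y by apply: nextO; case: tI.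
  (* Either a step was taken earlier in the pass, or the walk is still at [t] when the pair (p, q)
     comes up. *)
  apply: (foldl_hit (fun t' => t' = t) (Q t) _ _ _ _ (mem_enum _ p)) => //.
  - move=> _ p1 ->.
    have: t = t \/ Q t t by left.
    apply: (foldl_inv (P := fun t' => t' = t \/ Q t t')) => t1 q1 [->|Qt1].
      exact: stepP.
    by right; apply: stepQ.
  - by move=> t1 p1; apply: rowQ.
  move=> _ ->; apply: (foldl_hit (fun t' => t' = t) (Q t) _ _ _ _ (mem_enum _ q)) => //.
  - by move=> _ q1 ->; apply: stepP.
  - by move=> t1 q1; apply: stepQ.
  move=> _ ->; rewrite /walk_step /= eqxx Xl.
  exact: (move_on t p q l y).
have init : winv (ord0, Some l0, [::]).
  by split=> // w2 rw2 lw2 w2E; split.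
have iterP j : let t := iter j walk_all (ord0, Some l0, [::]) in
    winv t /\ (t.1.2 = None \/ j <= size t.2).
  elim: j => [|j]; first by split=> //; right.
  rewrite iterS; case: (iter j _ _) => [[p [l|]] w] /= [tI tS]; last first.
    by rewrite walk_all_stop; split=> //; left.
  have [tI' lt] := progress _ l tI erefl; split=> //; right.
  by case: tS => // jw; apply: leq_ltn_trans lt.
have := iterP m.+1; case: (iter m.+1 _ _) => [[p x] w] /= [tI tS].
case: tI => /= xO sz cont.
case: x xO sz cont tS => [l|] xO sz cont tS.
  (* An unfinished walk would have emitted [m.+1] letters with a positive rank left, more than the
     initial rank, which is at most [m.+1]. *)
  case: tS => // wS; have [q [y Xl]] := nextO _ _ xO.
  have [_ _ _ _ rkl] := rkX _ _ _ _ Xl.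
  have := leq_trans (leq_add wS (leq_ltn_trans (leq0n _) rkl)) (leq_trans sz (rkO _ _ l0O)).
  by rewrite addn1 => /(leq_trans)/(_ k_le); rewrite ltnn.
have p0 : p = ord0 by apply/eqP; rewrite -O0.
have [] := cont [::] isT p0 erefl; rewrite cats0 => rw lw w0.
exists w, p; split=> //; first by case: (w) w0.
move=> w' w'0 rw' lw'; apply: leq_trans (min w' w'0 rw' lw').
by apply: leq_trans sz; apply: leq_addr.
Qed.

End Walk.
End Search.

(** * The whole program and its correctness *)

Definition search_prog : tprog :=
  Then graph_prog (Then saturate_prog (Then bfs_prog (Then (For ptr0 start_body)
    (Then walk_prog (Emit _ (fun u => if found u is Some _ then Some (end_marker A) else None)))))).

Definition initial_seen p : labels := if p == ord0 then [set None] else set0.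

Definition no_next (p q : vertex) : next_table := [ffun=> None].
Definition empty1 (p : vertex) : labels := set0.
Definition empty2 (p q : vertex) : labels := set0.

Lemma bfs_inv_initial E : bfs_inv E 0 None initial_seen empty1 no_next.
Proof.
have in_seen p x : (x \in initial_seen p) = (p == ord0) && (x == None).
  by rewrite /initial_seen; case: eqP; rewrite inE.
split=> [p|p|p [|//] _ _ /= ->|]; rewrite ?in_seen ?eqxx ?andbT ?sub0set //.
exists (fun _ _ => 0); split=> // [p l|p q l y|l]; rewrite ?in_seen ?andbF //.
by rewrite ffunE.
Qed.

Lemma sem_start E o rho f O N X h :
  (forall p, (None \in O p) = (p == ord0)) ->
  bfs_state E o f O N X h ->
  exists u, [/\ found u = f, reg_a u = f &
    sem (For ptr0 start_body) rho h = (u, tab E O N X (fun a => a == ord0), o)].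
Proof.
move=> O0 [u [fu ->]].
pose I k (h : state m) := exists u H, [/\ found u = f, 0 < k -> reg_a u = f,
  h = (u, tab E O N X H, o) & forall a : vertex, a < k -> H a = (a == ord0)].
suff [u' [H [fu' ru' -> HE]]] : I m.+1 (sem (For ptr0 start_body) rho (u, tab E O N X nowhere, o)).
  exists u'; split=> //; first exact: ru'.
  by congr (_, _, _); apply: eq_tab => // a; apply: HE.
rewrite sem_For; apply: foldl_enum_ind; first by exists u, nowhere.
move=> p h1 [u1 [H1 [fu1 ru1 -> HE]]]; rewrite /start_body semE [repoint _ _ _ _]/= !tabE.
eexists; exists (upd1 H1 p (None \in O p)); split; last first.
- move=> a; rewrite ltnS leq_eqVlt => /orP[/eqP/val_inj->|ap]; last rewrite /upd1.
    by rewrite /upd1 eqxx O0.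
  by rewrite ifN ?HE // -val_eqE neq_ltn ap.
- by [].
- by [].
- by [].
Qed.

(** When nothing is found, [m.+1] rounds of search exclude only the words of at most [m.+1] letters;
    the triviality of the subgroup is drawn from this by looking at the generators. *)
Lemma sem_search_prog u rho : found u = None ->
  exists E,
    [/\ saturated E, forall p q, bouquet mk p q \subset E p q,
        forall p q x, x \in E p q -> path_label (bouquet mk) p q (short_elt x)
      & exists ans, (sem search_prog rho
            (u, tab empty2 initial_seen empty1 no_next nowhere, [::])).2 = encode_answer ans /\
        if ans is Some w then
          [/\ reduced w, w != [::], leads_to ord0 E ord0 w
            & forall w', w' != [::] -> reduced w' -> leads_to ord0 E ord0 w' -> size w <= size w']
        else forall w, w != [::] -> reduced w -> leads_to ord0 E ord0 w -> m.+1 < size w].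
Proof.
move=> fu; rewrite /search_prog 5!sem_Then.
have [u1 [E0 [fu1 h1E E0E]]] := sem_graph_prog rho u initial_seen empty1 no_next [::].
rewrite [sem graph_prog _ _]h1E.
have st1 : edge_state initial_seen empty1 no_next [::] None
    (u1, tab E0 initial_seen empty1 no_next nowhere, [::]) E0.
  by exists u1; rewrite fu1.
have := sem_saturate_prog rho st1; have closed := saturate_prog_closed E0.
set E := iter _ _ _ in closed * => st2; set h2 := sem saturate_prog _ _ in st2 *.
have E0_E : mem_le E0 E.
  by apply: (@iter_saturate_inv (mem_le E0)) => // p q r E1; apply: mem_le_add.
have [f [O [N [X [st3 inv]]]]] := sem_bfs_prog rho st2 (bfs_inv_initial E).
set h3 := sem bfs_prog _ _ in st3 *.
have [O0 _ complete [rk [_ _ _ fP]]] := inv.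
have [u4 [fu4 ru4 ->]] := sem_start rho O0 st3.
exists E; split.
- split=> [p|p q r x y z xE yE xy].
    by apply: (subsetP (E0_E p p)); rewrite E0E inE eqxx.
  by apply: (subsetP (closed p q r)); apply/label_productP; exists x, y.
- by move=> p q; rewrite -E0E.
- have: forall p q x, x \in E0 p q -> path_label (bouquet mk) p q (short_elt x).
    by move=> p q x; rewrite E0E; apply: path_label_edge.
  apply: (@iter_saturate_inv (fun E => forall p q x, x \in E p q ->
    path_label (bouquet mk) p q (short_elt x))) => p q r E1 sound a b x.
  rewrite in_add_edge => /orP[/sound//|/and3P[/eqP-> /eqP-> /label_productP[y [z [yE zE yz]]]]].
  by rewrite (short_elt_mul yz); apply: path_label_cat (sound _ _ _ yE) (sound _ _ _ zE).
have st4 : walk_state E f O N X (u4, tab E O N X (fun a => a == ord0), [::]) (ord0, f, [::]).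
  by exists u4.
have := sem_walk_prog rho st4; set h4 := sem walk_prog _ _.
case: f inv fP fu4 ru4 st3 {st4} => [l|] inv fP fu4 ru4 st3.
  have [w [pos [-> rw w0 lw min]]] := walk_allP inv (leqnn _).
  case=> u5 [fu5 _ ->]; exists (Some w); split=> //.
  by rewrite sem_Emit /do_emit /= fu5.
have -> : iter m.+1 (walk_all X) (ord0, None, [::]) = (ord0, None, [::]).
  by apply: iter_fix; apply: walk_all_stop.
case=> u5 [fu5 _ ->]; exists None; split; first by rewrite sem_Emit /do_emit /= fu5.
move=> w w0 rw lw; rewrite ltnNge; apply/negP=> sw.
have := complete _ _ sw rw lw; case: w w0 {rw lw sw} => //= l w _.
by rewrite (negPf (fP l)).
Qed.

End Tables.

Definition symbol_mark (s : S) : short := if s is inl l then Some l else None.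

Definition initial_cell (fr : bool) (x : option S) : tcell :=
  TCell (obind symbol_mark x) set0 (if fr && (x == None) then [set None] else set0) set0
    [ffun=> None] false.

Definition initial_regs : regs := Regs set0 set0 None None None false false.

Lemma init_table_tab (s : seq S) :
  init_table initial_cell s =
  tab (fun p : 'I_(size s).+1 => obind symbol_mark (column_symbol s p))
    (@empty2 _) (@initial_seen _) (@empty1 _) (@no_next _) (@nowhere _).
Proof.
apply/ffunP=> -[a b]; rewrite !ffunE /initial_cell /nowhere andbF column_symbol_None /=.
congr TCell; rewrite /initial_seen /empty1; last by case: ifP.
case: (eqVneq a b) => [<-|ab]; first by rewrite -!(inj_eq val_inj) /= andbb.
case: eqP => //= a0; case: eqP => //= b0.
by case/eqP: ab; apply: val_inj; rewrite /= a0 b0.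
Qed.

Lemma nested_search_prog : nested 5 search_prog.
Proof.
have rep n k (p : tprog) : nested n p -> nested n (repeat_prog k p).
  by move=> np; elim: k => //= k ->; rewrite np.
by rewrite /search_prog /= /saturate_prog rep.
Qed.

Lemma marked_encode_words (hs : seq (word A)) : marked hs = map symbol_mark (encode_words hs).
Proof.
rewrite /marked /encode_words map_flatten -map_comp; congr flatten; apply: eq_map => h /=.
by rewrite /encode_word map_rcons -map_comp.
Qed.

Lemma size_reduce_encode (hs : seq (word A)) h :
  h \in hs -> size (reduce h) <= size (encode_words hs).
Proof.
move=> hin; apply: leq_trans (size_reduce h) _; rewrite size_encode_words.
by rewrite (big_rem h) //= ltnW // leq_addr.
Qed.

(** If the search finds nothing, every generator is trivial, since the reduced word of a nontrivial
    one is no longer than the input and so within the range of the search. *)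
Lemma search_progP (hs : seq (word A)) : exists ans,
  (sem search_prog (fun=> ord0) (initial_regs, init_table initial_cell (encode_words hs), [::])).2
    = encode_answer ans /\ shortest_element hs ans.
Proof.
set s := encode_words hs; rewrite init_table_tab; set mk := fun _ => obind _ _.
have size_s : size (marked hs) = size s by rewrite marked_encode_words size_map.
have mkE p : mk p = nth None (None :: marked hs) p.
  rewrite /mk /column_symbol marked_encode_words; case: p => -[|p] //= lt_p.
  by rewrite (nth_map (end_marker A)) // (nth_map (end_marker A)).
have [E [sat sub sound [ans [-> ansP]]]] :=
  @sem_search_prog _ mk initial_regs (fun=> ord0) erefl.
exists ans; split=> //; rewrite /shortest_element.
have labelP := path_label_generated size_s mkE.
have leads g : generated [seq element_of h | h <- hs] g -> g != 1%g ->
    reduced_word g != [::] /\ leads_to ord0 E ord0 (reduced_word g).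
  move=> /labelP Hg g1; have w0 : reduced_word g != [::].
    by apply: contra g1 => /eqP g0; rewrite -(element_ofK g) g0 element_of_nil.
  by split=> //; apply: spells_leads_to => //; apply: path_label_spells Hg.
case: ans ansP => [w [rw w0 lw min]|none].
  split.
  - by apply/labelP/(spells_path_label sound)/leads_to_spells => //; case: sat.
  - by rewrite element_of_eq1.
  move=> g Hg g1; have [v0 lv] := leads g Hg g1.
  by rewrite /word_length val_element_of reduce_id //; apply: min => //; apply: valP.
move=> g Hg; apply: (generated_trivial Hg) => _ /mapP[h hin ->].
apply/eqP/negPn/negP=> h1.
have [|v0 lv] := leads (element_of h) _ h1; first exact/generated_mem/map_f.
have := none _ v0 (valP (element_of h)) lv.
by rewrite val_element_of ltnNge ltnW // ltnS size_reduce_encode.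
Qed.

End Algorithm.

Theorem theorem5p1 (A : finType) :
  in_P (@encode_words A) (@encode_answer A) (@shortest_element A).
Proof.
have [P PP] := table_machineP (@initial_cell A) (initial_regs A) (nested_search_prog A).
exists (table_machine (@initial_cell A) (initial_regs A) (search_prog A)), P => hs.
have [ans [ansE ansP]] := search_progP hs.
have [t tP halt] := PP (encode_words hs).
by exists ans, t; split=> //; rewrite -ansE.
Qed.
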